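(* Consider the family of problems, for $\theta\in\Theta$, $$(Q_\theta)\qquad\min_{x\in\mathbb{R}^N}\ x^\top F_\theta x\quad\text{s.t.}\quad g^i_\theta(x):=x^\top G^i_\theta x+c^i_\theta=0,\quad i=1,\dots,m,$$ where $F_\theta,G^i_\theta\in\mathbb{S}^N$ and $c^i_\theta\in\mathbb{R}$ are continuously differentiable functions of $\theta$ and for each $\theta$ at least one $c^i_\theta$ is nonzero. Let $\bar\theta\in\Theta$ be a zero duality gap parameter, let $\bar x$ be optimal for $(Q_{\bar\theta})$ and $\bar\lambda$ optimal for $(D_{\bar\theta})$, and put $\bar H:=F_{\bar\theta}+\sum_i\bar\lambda_iG^i_{\bar\theta}$, $\mathbf{X}_\theta:=\{x\in\mathbb{R}^N:g_\theta(x)=0\}$, $\bar{\mathbf{X}}:=\mathbf{X}_{\bar\theta}$. Assume that: (i) (ACQ) $\mathrm{ACQ}_{\bar{\mathbf{X}}}(\bar x)$ holds; (ii) (smoothness) the mapping $\theta\mapsto\mathbf{X}_\theta$ is smooth nearby $(\bar\theta,\bar x)$; (iii) (non-branch point) $\bar x$ is not a branch point of $\bar{\mathbf{X}}$ with respect to the linear map $x\mapsto\bar Hx$; (iv) (restricted Slater) the restricted Slater condition holds at $(\bar x,\bar\lambda)$. Then $(Q_\theta)$ is SDP-stable near $\bar\theta$, and for $\theta$ near $\bar\theta$ the relaxation $(P_\theta)$ recovers the minimizer of $(Q_\theta)$.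
   Context: $\Theta\subseteq\mathbb{R}^d$ is the parameter space, a smooth submanifold of $\mathbb{R}^d$ (e.g. an open subset), so that $\dim\Theta$ and differentiability in $\theta$ make sense. $\mathbb{S}^N$ denotes real symmetric $N\times N$ matrices and $\bullet$ the trace inner product. The SDP relaxations of $(Q_\theta)$ are $$(P_\theta)\quad\min_{S\in\mathbb{S}^N}F_\theta\bullet S\ \text{ s.t. } G^i_\theta\bullet S+c^i_\theta=0\ \forall i,\ S\succeq0;\qquad(D_\theta)\quad\max_{\lambda\in\mathbb{R}^m}\sum_i\lambda_ic^i_\theta\ \text{ s.t. } F_\theta+\sum_i\lambda_iG^i_\theta\succeq0.$$ $\theta$ is a zero duality gap parameter if $\mathrm{val}(Q_\theta)=\mathrm{val}(P_\theta)=\mathrm{val}(D_\theta)$ (optimal values). The family is SDP-stable near $\bar\theta$ if these equalities hold for all $\theta$ in a neighborhood of $\bar\theta$ in $\Theta$. ''$(P_\theta)$ recovers the minimizer'' means that $(P_\theta)$ has a unique optimal solution, equal to $xx^\top$ with $x$ an optimal solution of $(Q_\theta)$ (unique up to sign). ACQ: for $x\in\bar{\mathbf{X}}$, $\mathrm{ACQ}_{\bar{\mathbf{X}}}(x)$ holds if $\bar{\mathbf{X}}$ is a smooth manifold near $x$ and $\mathrm{rank}\,\nabla g_{\bar\theta}(x)=\mathrm{codim}_x\bar{\mathbf{X}}:=N-\dim_x\bar{\mathbf{X}}$ ($\nabla g_{\bar\theta}$ the Jacobian of $g_{\bar\theta}=(g^1_{\bar\theta},\dots,g^m_{\bar\theta})$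 in $x$). Smoothness: $\theta\mapsto\mathbf{X}_\theta$ is smooth nearby $\bar w:=(\bar\theta,\bar x)$ if its graph $\mathbf{W}:=\{(\theta,x):x\in\mathbf{X}_\theta\}$ is a smooth manifold near $\bar w$ and $\dim_{\bar w}\mathbf{W}=\dim\Theta+\dim_{\bar x}\bar{\mathbf{X}}$. Branch point: $x\in\bar{\mathbf{X}}$ is a branch point of $\bar{\mathbf{X}}$ with respect to a linear map $\pi$ on $\mathbb{R}^N$ if $\ker(\pi)\cap T_x\bar{\mathbf{X}}\ne0$, where $T_x\bar{\mathbf{X}}:=\ker\nabla g_{\bar\theta}(x)$. Restricted Slater at $(\bar x,\bar\lambda)$: there exists $\lambda'\in\mathbb{R}^m$ such that the quadratic function $\Psi_{\lambda'}(x):=\sum_i\lambda'_ig^i_{\bar\theta}(x)$ is strictly convex on the subspace $V:=\{v\in\mathbb{R}^N:\bar Hv=0,\ \bar x^\top v=0\}$, and $\nabla\Psi_{\lambda'}(\bar x)=2\sum_i\lambda'_iG^i_{\bar\theta}\bar x=0$. *)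

(* Defs.v *)
From mathcomp Require Import all_boot all_order all_algebra.
From mathcomp Require Import boolp classical_sets functions reals ereal.
From mathcomp Require Import topology normedtype derive.

Set Implicit Arguments.
Unset Strict Implicit.
Unset Printing Implicit Defensive.

Import Order.TTheory GRing.Theory Num.Theory.
Import numFieldNormedType.Exports.

Local Open Scope classical_set_scope.
Local Open Scope ring_scope.

Section Manifolds.
Context {R : realType}.
Implicit Types E F : normedModType R.

(* For open U. In finite dimension, pointwise continuity of the differential
   is the same as continuity in operator norm. *)
Definition C1_on E F (U : set E) (f : E -> F) : Prop :=
  (forall x, U x -> differentiable f x) /\
  (forall v x, U x -> {for x, continuous (fun y => 'd f y v)}).

(* The data of a parametric problem are given on a subset M (a submanifold)
   only; as usual, f is C^1 on M if it locally extends to a C^1 function on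
   the ambient space. *)
Definition C1_along E F (M : set E) (f : E -> F) : Prop :=
  forall x, M x -> exists (U : set E) (g : E -> F),
    [/\ open U, U x, C1_on U g & forall y, U y -> M y -> g y = f y].

(* "Smooth" is C^1 throughout, the regularity assumed on the data: the graph
   of theta |-> X_theta cannot be smoother than the data in general.
   M is a k-dimensional submanifold near x in M: some C^1 diffeomorphism phi
   from an open U containing x onto an open V of R^k * R^c, with inverse psi,
   maps the trace of M on U to that of R^k * 0 on V. The dimension k + c of
   the ambient E is imposed by the existence of phi. *)
Definition manifold_near E (M : set E) (x : E) (k : nat) : Prop :=
  M x /\
  exists (c : nat) (U : set E) (V : set ('cV[R]_k * 'cV[R]_c)%type)
         (phi : E -> ('cV[R]_k * 'cV[R]_c)%type)
         (psi : ('cV[R]_k * 'cV[R]_c)%type -> E),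
    [/\ open U /\ U x, open V,
        C1_on U phi /\ C1_on V psi,
        (forall y, U y -> V (phi y) /\ psi (phi y) = y) /\
        (forall z, V z -> U (psi z) /\ phi (psi z) = z)
      & forall y, U y -> (M y <-> (phi y).2 = 0)].

Definition is_manifold_near E (M : set E) (x : E) : Prop :=
  exists k, manifold_near M x k.

(* The k of manifold_near is unique when it exists; 0 is a default value. *)
Definition local_dim E (M : set E) (x : E) : nat :=
  xget 0%N [set k | manifold_near M x k].

Definition submanifold E (M : set E) (k : nat) : Prop :=
  forall x, M x -> manifold_near M x k.

End Manifolds.

Section Calculus.
Context {R : realType} {N : nat}.
Implicit Types (x : 'cV[R]_N) (V : set 'cV[R]_N).

Definition gradient (f : 'cV[R]_N -> R) x : 'cV[R]_N :=
  \col_j 'D_(delta_mx j 0) f x.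

(* Rows are gradients; this is the transpose of the convention of derive.v. *)
Definition jacobian_mx m (g : 'cV[R]_N -> 'cV[R]_m) x : 'M[R]_(m, N) :=
  \matrix_(i, j) 'D_(delta_mx j 0) (fun y => g y i 0) x.

Definition strictly_convex_on V (f : 'cV[R]_N -> R) : Prop :=
  forall u v (t : R), V u -> V v -> u <> v -> 0 < t < 1 ->
    f (t *: u + (1 - t) *: v) < t * f u + (1 - t) * f v.

Definition quadform (A : 'M[R]_N) x : R := (x^T *m A *m x) 0 0.

Definition psd (A : 'M[R]_N) : Prop :=
  A^T = A /\ forall v : 'cV[R]_N, 0 <= quadform A v.

Definition trace_inner (A B : 'M[R]_N) : R := \tr (A^T *m B).

End Calculus.

(* minimize x^T F x subject to x^T G_i x + c_i = 0 for all i *)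
Record qcqp (R : realType) (N m : nat) := QCQP {
  obj_mx : 'M[R]_N;
  con_mx : 'I_m -> 'M[R]_N;
  con_cst : 'I_m -> R }.

Section Qcqp.
Context {R : realType} {N m : nat}.
Implicit Types (q : qcqp R N m) (x : 'cV[R]_N) (S : 'M[R]_N) (l : 'cV[R]_m).

Definition con_fun q x : 'cV[R]_m :=
  \col_i (quadform (con_mx q i) x + con_cst q i).

Definition Qfeasible q : set 'cV[R]_N := [set x | con_fun q x = 0].
Definition Qobj q x : R := quadform (obj_mx q) x.
Definition Qopt q x : Prop :=
  Qfeasible q x /\ forall y, Qfeasible q y -> Qobj q x <= Qobj q y.
Definition Qval q : \bar R := ereal_inf [set (Qobj q x)%:E | x in Qfeasible q].

Definition Pfeasible q : set 'M[R]_N :=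
  [set S | psd S /\ forall i, trace_inner (con_mx q i) S + con_cst q i = 0].
Definition Pobj q S : R := trace_inner (obj_mx q) S.
Definition Popt q S : Prop :=
  Pfeasible q S /\ forall T, Pfeasible q T -> Pobj q S <= Pobj q T.
Definition Pval q : \bar R := ereal_inf [set (Pobj q S)%:E | S in Pfeasible q].

Definition slack_mx q l : 'M[R]_N := obj_mx q + \sum_i l i 0 *: con_mx q i.

Definition Dfeasible q : set 'cV[R]_m := [set l | psd (slack_mx q l)].
Definition Dobj q l : R := \sum_i l i 0 * con_cst q i.
Definition Dopt q l : Prop :=
  Dfeasible q l /\ forall l', Dfeasible q l' -> Dobj q l' <= Dobj q l.
Definition Dval q : \bar R := ereal_sup [set (Dobj q l)%:E | l in Dfeasible q].

Definition zero_duality_gap q : Prop := Qval q = Pval q /\ Pval q = Dval q.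

Definition recovers_minimizer q : Prop :=
  exists x, (forall y, Qopt q y <-> y = x \/ y = - x) /\
            (forall S, Popt q S <-> S = x *m x^T).

Definition ACQ q x : Prop :=
  is_manifold_near (Qfeasible q) x /\
  \rank (jacobian_mx (con_fun q) x) = (N - local_dim (Qfeasible q) x)%N.

Definition tangent_space q x : set 'cV[R]_N :=
  [set v | jacobian_mx (con_fun q) x *m v = 0].

Definition branch_point q n (pi : {linear 'cV[R]_N -> 'cV[R]_n}) x : Prop :=
  Qfeasible q x /\ exists v, [/\ v <> 0, pi v = 0 & tangent_space q x v].

Definition restricted_Slater q x l : Prop :=
  exists l' : 'cV[R]_m,
    let Psi y := \sum_i l' i 0 * con_fun q y i 0 in
    strictly_convex_on
      [set v | slack_mx q l *m v = 0 /\ x^T *m v = 0] Psi /\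
    gradient Psi x = 0.

End Qcqp.

Section Family.
Context {R : realType} {d N m : nat}.
Implicit Types (Theta : set 'cV[R]_d) (Q : 'cV[R]_d -> qcqp R N m).

Definition feasible_graph Theta Q : set ('cV[R]_d * 'cV[R]_N)%type :=
  [set w | Theta w.1 /\ Qfeasible (Q w.1) w.2].

(* p stands for the dimension of Theta *)
Definition feasible_smooth_near Theta (p : nat) Q
    (theta : 'cV[R]_d) (x : 'cV[R]_N) : Prop :=
  is_manifold_near (feasible_graph Theta Q) (theta, x) /\
  local_dim (feasible_graph Theta Q) (theta, x) =
    (p + local_dim (Qfeasible (Q theta)) x)%N.

Definition near_in Theta (theta : 'cV[R]_d) (P : 'cV[R]_d -> Prop) : Prop :=
  \forall t \near within Theta (nbhs theta), P t.

Definition SDP_stable_near Theta Q (theta : 'cV[R]_d) : Prop :=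
  near_in Theta theta (fun t => zero_duality_gap (Q t)).

End Family.

(* Main.v *)
Require Import Defs.
From HB Require Import structures.
From mathcomp Require Import all_boot all_order all_algebra.
From mathcomp Require Import boolp classical_sets functions reals ereal.
From mathcomp Require Import topology normedtype derive.
From mathcomp Require Import sequences sesquilinear zify ring lra.

(** A point x of X_theta is certified optimal, with zero duality gap and with
    x x^T as unique solution of the relaxation, by a multiplier l such that
    H := slack_mx (Q theta) l satisfies H x = 0 and H + x x^T is positive
    definite, i.e. H is positive semidefinite with kernel spanned by x
    (kkt_certificate). Positive definiteness is an open condition
    (cvg_near_pd), so the theorem reduces to finding, for theta near thetab,
    some x in X_theta and some l with H x = 0 which are close to a pair
    certified at thetab.

    At thetab, zero duality gap gives Hb xb = 0. The restricted Slater
    condition gives A = sum_i l'_i G_i with A xb = 0 and positive on the part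
    of ker Hb orthogonal to xb, so that by Debreu's lemma (debreu) the
    multiplier l0 = lb + t l' is a certificate for a small t > 0
    (corank_one_multiplier).

    To move theta, let u range over R^(p + k), the parameters of a chart of the
    graph W of theta |-> X_theta at (thetab, xb), with k = dim_xb X_thetab, and
    write (theta(u), x(u)) for the corresponding point of W and a(u) in R^p for
    the coordinates of theta(u) in the submanifold Theta. The feasibility of
    x(u) for theta(u) is thus built in, and what has to be solved is
      a(u) = (coordinates of theta),  slack_mx (Q (theta u)) l *m x(u) = 0
    in the unknowns (u, l), near (u0, l0). This map is C^1, hence locally onto
    as soon as its differential is onto (local_surjectivity, by the contraction
    principle), which is linear algebra (kkt_local). Let J be the matrix whose
    rows are the (G_i xb)^T. Feasibility makes x'(u0) send ker a'(u0) into
    ker J, injectively because W is embedded. ACQ says dim ker J <= k, and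
    dim ker a'(u0) >= k, so that x'(u0) sends ker a'(u0) onto ker J, and a'(u0)
    is onto (kernel_dimension_count). It remains to solve H w + J^T l = eta with
    w in ker J, which is possible because the form of H vanishes only at 0 on
    ker J (kkt_solvable): its zeros are multiples of xb, and J xb is nonzero
    since some c_i is. *)

Set Implicit Arguments.
Unset Strict Implicit.
Unset Printing Implicit Defensive.

Import Order.TTheory GRing.Theory Num.Theory.
Import numFieldNormedType.Exports.

Local Open Scope classical_set_scope.
Local Open Scope ring_scope.

(** * Quadratic forms and the linear algebra of the KKT system *)

Section QuadraticForms.
Context {R : realType} {N : nat}.
Implicit Types (A H K : 'M[R]_N) (u v w x : 'cV[R]_N).

Definition dotv u v : R := (u^T *m v) 0 0.

Definition pd A : Prop := forall v, v != 0 -> 0 < quadform A v.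

Lemma dotvE u v : dotv u v = \sum_i u i 0 * v i 0.
Proof. by rewrite /dotv mxE; apply: eq_bigr => i _; rewrite mxE. Qed.

Lemma dotvC u v : dotv u v = dotv v u.
Proof. by rewrite !dotvE; apply: eq_bigr => i _; rewrite mulrC. Qed.

Lemma dotvr0 u : dotv u 0 = 0.
Proof. by rewrite /dotv mulmx0 mxE. Qed.

Lemma dotvDr u v w : dotv u (v + w) = dotv u v + dotv u w.
Proof. by rewrite /dotv mulmxDr mxE. Qed.

Lemma dotvZr u t v : dotv u (t *: v) = t * dotv u v.
Proof. by rewrite /dotv -scalemxAr mxE. Qed.

Lemma dotvNr u v : dotv u (- v) = - dotv u v.
Proof. by rewrite /dotv mulmxN mxE. Qed.

Lemma dotv_gt0 v : v != 0 -> 0 < dotv v v.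
Proof.
move=> v0; rewrite lt_neqAle dotvE; apply/andP; split; last first.
  by apply: sumr_ge0 => i _; rewrite -expr2 sqr_ge0.
apply: contra v0 => /eqP /esym h; apply/eqP/colP => i; rewrite mxE.
have := @psumr_eq0P _ _ predT _ (fun i _ => sqr_ge0 (v i 0)) h i isT.
by move/eqP; rewrite mulf_eq0 orbb => /eqP.
Qed.

Lemma quadform_dotv A v : quadform A v = dotv v (A *m v).
Proof. by rewrite /quadform /dotv mulmxA. Qed.

Lemma dotv_sym A u v : A^T = A -> dotv u (A *m v) = dotv v (A *m u).
Proof. by move=> sA; rewrite dotvC /dotv trmx_mul sA mulmxA. Qed.

Lemma quadformD A u v : A^T = A ->
  quadform A (u + v) = quadform A u + quadform A v + 2 * dotv u (A *m v).
Proof.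
move=> sA; rewrite !quadform_dotv mulmxDr !dotvDr.
rewrite ![dotv (u + v) _]dotvC !dotvDr.
rewrite ![dotv (A *m _) _]dotvC (dotv_sym v u sA); ring.
Qed.

Lemma quadformZ A t v : quadform A (t *: v) = t ^+ 2 * quadform A v.
Proof.
rewrite !quadform_dotv -scalemxAr dotvZr dotvC dotvZr dotvC; ring.
Qed.

Lemma quadform_mxD A B v : quadform (A + B) v = quadform A v + quadform B v.
Proof. by rewrite !quadform_dotv mulmxDl dotvDr. Qed.

Lemma quadform_mxZ t A v : quadform (t *: A) v = t * quadform A v.
Proof. by rewrite !quadform_dotv -scalemxAl dotvZr. Qed.

Lemma quadform_mxsum (I : finType) (A : I -> 'M[R]_N) v :
  quadform (\sum_i A i) v = \sum_i quadform (A i) v.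
Proof.
by rewrite /quadform mulmx_sumr mulmx_suml summxE.
Qed.

Lemma quadform_outer x v : quadform (x *m x^T) v = dotv x v ^+ 2.
Proof.
rewrite quadform_dotv -mulmxA [x^T *m v]mx11_scalar mul_mx_scalar dotvZr.
by rewrite [dotv v x]dotvC expr2.
Qed.

(** Along v + t A v the form is 2 t |A v|^2 + O(t^2), so it would be
    negative for some small t < 0 if A v were nonzero. *)
Lemma psd_form_eq0 A v : psd A -> quadform A v = 0 -> A *m v = 0.
Proof.
move=> [sA pA] qv; apply/eqP; apply: contraT => /dotv_gt0.
set w := A *m v => b0; set b := dotv w w in b0.
have q0 := pA w; set q := quadform A w in q0.
have := pA (v + (- (b / (q + 1))) *: w).
rewrite quadformD // qv quadformZ -/q -scalemxAr dotvZr.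
rewrite (dotv_sym v w sA) -/w -/b; move: b0 q0; clearbody b q; clear.
move=> b0 q0; have q1 : 0 < q + 1 by lra.
have -> : 0 + (- (b / (q + 1))) ^+ 2 * q + 2 * (- (b / (q + 1)) * b)
   = - ((b / (q + 1)) ^+ 2 * (q + 2)) by field; lra.
have t0 : 0 < b / (q + 1) by rewrite divr_gt0.
have : 0 < (b / (q + 1)) ^+ 2 * (q + 2).
  by apply: mulr_gt0; [rewrite exprn_gt0 | lra].
by lra.
Qed.

(** Splitting v = t x + w with w orthogonal to x: A sees only w, and on w it
    agrees with A + x x^T. *)
Lemma pd_outer_psd A x v : A^T = A -> A *m x = 0 -> x != 0 ->
  pd (A + x *m x^T) ->
  0 <= quadform A v /\ (quadform A v = 0 -> exists t, v = t *: x).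
Proof.
move=> sA Ax x0 pK; pose t := dotv x v / dotv x x; pose w := v - t *: x.
have xx := dotv_gt0 x0.
have vE : v = w + t *: x by rewrite /w subrK.
have xw : dotv x w = 0.
  by rewrite /w dotvDr dotvNr dotvZr /t divfK ?subrr // gt_eqF.
have qE : quadform A v = quadform (A + x *m x^T) w.
  rewrite vE quadformD // quadformZ [quadform A x]quadform_dotv.
  rewrite -scalemxAr Ax scaler0 !dotvr0 !mulr0.
  by rewrite quadform_mxD quadform_outer xw expr0n /= !addr0.
have [w0|wn0] := eqVneq w 0.
  split; last by exists t; rewrite vE w0 add0r.
  by rewrite qE w0 quadform_dotv mulmx0 dotvr0.
by split; rewrite qE; [exact/ltW/pK | move/eqP; rewrite gt_eqF // pK].
Qed.

(** The image of ker J under H and the rows of J span everything: a vector w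
    orthogonal to the rows of J lies in ker J, and if it is also orthogonal to
    H (ker J), then in particular to H w. *)
Lemma kkt_solvable m (J : 'M[R]_(m, N)) H : H^T = H ->
  (forall w, J *m w = 0 -> quadform H w = 0 -> w = 0) ->
  forall eta, exists v l, J *m v = 0 /\ H *m v + J^T *m l = eta.
Proof.
move=> sH HJ eta; pose Kr := kermx J^T.
pose M := col_mx (Kr *m H) J.
have : (eta^T <= M)%MS.
  apply: submx_full; rewrite -col_leq_rank -mxrank_tr.
  rewrite row_leq_rank -kermx_eq0; apply/eqP/row_matrixP => i; rewrite row0.
  set r := row i _.
  have : r *m M^T = 0 by apply/sub_kermxP; rewrite row_sub.
  rewrite /M tr_col_mx mul_mx_row => /eqP; rewrite row_mx_eq0.
  move=> /andP [/eqP rKH /eqP rJ].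
  have Jr : J *m r^T = 0 by rewrite -[J]trmxK -trmx_mul rJ trmx0.
  suff : r^T = 0 by move=> h; rewrite -[r]trmxK h trmx0.
  apply: HJ => //.
  have /submxP [D rD] : (r <= Kr)%MS by apply/sub_kermxP.
  have KHr : Kr *m H *m r^T = 0 by rewrite -[_ *m H]trmxK -trmx_mul rKH trmx0.
  rewrite /quadform trmxK.
  have -> : r *m H *m r^T = D *m (Kr *m H *m r^T) by rewrite {1}rD !mulmxA.
  by rewrite KHr mulmx0 mxE.
move=> /submxP [D etaD].
exists (lsubmx D *m Kr)^T, (rsubmx D)^T; split.
  by rewrite -[J]trmxK -trmx_mul -mulmxA mulmx_ker mulmx0 trmx0.
rewrite -[eta]trmxK etaD -[D in RHS]hsubmxK /M mul_row_col linearD /= !trmx_mul.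
by rewrite sH !mulmxA.
Qed.

End QuadraticForms.

Section KernelDimensions.
Context {R : fieldType}.

(** Both conclusions come from counting dimensions: X is injective on ker A,
    so q - rank A <= dim X (ker A) <= dim ker J = N - rank J, and the
    hypothesis forces both inequalities to be equalities. *)
Lemma kernel_dimension_count q p N m
    (A : 'M[R]_(p, q)) (X : 'M[R]_(N, q)) (J : 'M[R]_(m, N)) :
  (forall v : 'cV_q, A *m v = 0 -> X *m v = 0 -> v = 0) ->
  (forall v : 'cV_q, A *m v = 0 -> J *m (X *m v) = 0) ->
  (N + p <= q + \rank J)%N ->
  (forall t : 'cV_p, exists v, A *m v = t) /\
  (forall w : 'cV_N, J *m w = 0 -> exists2 v, A *m v = 0 & X *m v = w).
Proof.
move=> XA JX dims; pose K := kermx A^T.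
have AK v : A *m v = 0 <-> (v^T <= K)%MS.
  split=> [Av|/sub_kermxP vA].
    by apply/sub_kermxP; rewrite -trmx_mul Av trmx0.
  by rewrite -[A]trmxK -[v]trmxK -trmx_mul vA trmx0.
have KXJ : (K *m X^T <= kermx J^T)%MS.
  apply/row_subP => i; rewrite row_mul; set r := row i K.
  have Ar : A *m r^T = 0 by apply/AK; rewrite trmxK row_sub.
  by apply/sub_kermxP; rewrite -[r]trmxK -!trmx_mul mulmxA -mulmxA JX // trmx0.
have rkKX : \rank (K *m X^T) = \rank K.
  apply/mxrank_injP/eqP/row_matrixP => i; rewrite row0; set r := row i _.
  have : (r <= K :&: kermx X^T)%MS by rewrite row_sub.
  rewrite sub_capmx => /andP [rK /sub_kermxP rX].
  suff : r^T = 0 by move=> r0; rewrite -[r]trmxK r0 trmx0.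
  apply: XA; first by apply/AK; rewrite trmxK.
  by rewrite -[X]trmxK -trmx_mul rX trmx0.
have := mxrankS KXJ; rewrite rkKX !mxrank_ker !mxrank_tr => le_ker.
have rA := rank_leq_row A; have rAq := rank_leq_col A.
have rJ := rank_leq_col J.
have rkA : \rank A = p by lia.
have rkE : (q - \rank A)%N = (N - \rank J)%N by lia.
split=> [t|w Jw].
  have : (t^T <= A^T)%MS by apply: submx_full; rewrite /row_full mxrank_tr rkA.
  move=> /submxP [D tD]; exists D^T.
  by rewrite -[A]trmxK -trmx_mul -tD trmxK.
have : (kermx J^T <= K *m X^T)%MS.
  rewrite -(geq_leqif (mxrank_leqif_sup KXJ)) rkKX !mxrank_ker !mxrank_tr.
  by rewrite rkE.
have wJ : (w^T <= kermx J^T)%MS by apply/sub_kermxP; rewrite -trmx_mul Jw trmx0.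
move=> /(submx_trans wJ) /submxP [D wD]; exists (D *m K)^T.
  by apply/AK; rewrite trmxK submxMl.
by rewrite -[X]trmxK -trmx_mul -mulmxA -wD trmxK.
Qed.

End KernelDimensions.

(** * Positive definiteness is an open condition *)

Section Convergence.
Context {R : realType}.

Lemma cvg_mx T (F : set_system T) {FF : Filter F} m n
    (f : T -> 'M[R]_(m, n)) (M : 'M[R]_(m, n)) :
  (forall i j, f x i j @[x --> F] --> M i j) -> f @ F --> M.
Proof.
move=> fM A [P nP sA].
have : \forall x \near F, forall i j, P i j (f x i j).
  by apply: filter_forall => i; apply: filter_forall => j; exact: fM (nP i j).
by apply: filterS => x; exact: sA.
Qed.

Lemma cvg_coord T (F : set_system T) {FF : Filter F} m n
    (f : T -> 'M[R]_(m, n)) (M : 'M[R]_(m, n)) i j :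
  f @ F --> M -> f x i j @[x --> F] --> M i j.
Proof. by move=> fM; apply: cvg_comp fM (@coord_continuous R m n i j M). Qed.

Lemma cvg_sumr T (F : set_system T) {FF : Filter F} (E : normedModType R)
    (I : Type) (r : seq I) (f : I -> T -> E) (l : I -> E) :
  (forall i, f i @ F --> l i) ->
  \sum_(i <- r) f i x @[x --> F] --> \sum_(i <- r) l i.
Proof. by move=> fl; apply: cvg_big => //; exact: add_continuous. Qed.

Lemma cvg_mulmx T (F : set_system T) {FF : Filter F} m n p
    (f : T -> 'M[R]_(m, n)) (g : T -> 'M[R]_(n, p))
    (A : 'M[R]_(m, n)) (B : 'M[R]_(n, p)) :
  f @ F --> A -> g @ F --> B -> f x *m g x @[x --> F] --> A *m B.
Proof.
move=> fA gB; apply: cvg_mx => i j; rewrite mxE.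
under eq_cvg do rewrite mxE.
apply: cvg_sumr => k; apply: cvgM; exact: cvg_coord.
Qed.

Lemma cvg_trmx T (F : set_system T) {FF : Filter F} m n
    (f : T -> 'M[R]_(m, n)) (A : 'M[R]_(m, n)) :
  f @ F --> A -> (f x)^T @[x --> F] --> A^T.
Proof.
move=> fA; apply: cvg_mx => i j; rewrite mxE.
by under eq_cvg do rewrite mxE; exact: cvg_coord.
Qed.

Lemma trmx_continuous m n : continuous (@trmx R m n).
Proof.
by move=> A; apply: (@cvg_trmx _ (nbhs A) _ _ _ id A); exact: cvg_id.
Qed.

Lemma cvg_quadform T (F : set_system T) {FF : Filter F} n
    (f : T -> 'M[R]_n) (g : T -> 'cV[R]_n)
    (A : 'M[R]_n) (v : 'cV[R]_n) :
  f @ F --> A -> g @ F --> v ->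
  quadform (f x) (g x) @[x --> F] --> quadform A v.
Proof.
move=> fA gv; apply: cvg_coord; apply: cvg_mulmx => //.
by apply: cvg_mulmx => //; exact: cvg_trmx.
Qed.

End Convergence.

Section PositiveDefiniteOpen.
Context {R : realType} {N : nat}.
Implicit Types (A K : 'M[R]_N) (v : 'cV[R]_N).

(** Written as the image of a set of row vectors, for which closed and bounded
    means compact. *)
Definition unit_sphere : set 'cV[R]_N :=
  trmx @` [set r : 'rV[R]_N | `|r| = 1].

Lemma unit_sphere_compact : compact unit_sphere.
Proof.
apply: continuous_compact; first exact/continuous_subspaceT/trmx_continuous.
apply: bounded_closed_compact.
  exists 1; split=> // M M1 r /= ->; exact: ltW.
have -> : [set r : 'rV[R]_N | `|r| = 1] = Num.norm @^-1` [set x | x = 1].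
  by apply/seteqP; split.
apply: closed_comp => [r _|]; [exact: norm_continuous | exact: closed_eq].
Qed.

Lemma unit_sphere_neq0 v : unit_sphere v -> v != 0.
Proof.
move=> [r /= r1 <-]; apply: contra_eq_neq r1 => /eqP.
by rewrite trmx_eq0 => /eqP ->; rewrite normr0 eq_sym oner_eq0.
Qed.

(** By homogeneity only the points of a sphere matter; it is compact, so that the
    parameters near the limit that are good around each point are good for all
    points at once. *)
Lemma near_pd T (F : set_system T) {FF : Filter F} (f : T -> 'M[R]_N) :
  (forall v, unit_sphere v ->
     \forall v' \near v & t \near F, 0 < quadform (f t) v') ->
  \forall t \near F, pd (f t).
Proof.
move=> /(proj1 (compact_near_coveringP _) unit_sphere_compact T F
  (fun t v => 0 < quadform (f t) v) FF).
apply: filterS => t tS v v0; have nv : 0 < `|v^T| by rewrite normr_gt0 trmx_eq0.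
have -> : v = `|v^T| *: (`|v^T|^-1 *: v).
  by rewrite scalerA divff ?gt_eqF // scale1r.
rewrite quadformZ mulr_gt0 ?exprn_gt0 //; apply: tS.
exists (`|v^T|^-1 *: v^T); last by rewrite linearZ /= trmxK.
by rewrite /= normrZ normfV normr_id mulVf // gt_eqF.
Qed.

Lemma cvg_near_pd T (F : set_system T) {FF : Filter F} (f : T -> 'M[R]_N) K :
  pd K -> f @ F --> K -> \forall t \near F, pd (f t).
Proof.
move=> pK fK; apply: near_pd => v /unit_sphere_neq0 v0.
have c : quadform (f x.2) x.1 @[x --> (nbhs v, F)] --> quadform K v.
  by apply: cvg_quadform; [apply: cvg_comp fK; exact: cvg_snd | exact: cvg_fst].
exact: cvgr_gt c _ (pK _ v0).
Qed.

(** Near a point of the sphere where K is positive, smallness of t suffices; near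
    the others A is positive, and any t > 0 will do since K >= 0. Compactness of
    the sphere makes the choice of t uniform. *)
Lemma debreu K A : (forall v, 0 <= quadform K v) ->
  (forall v, v != 0 -> quadform K v = 0 -> 0 < quadform A v) ->
  exists2 t : R, 0 < t & pd (K + t *: A).
Proof.
move=> K0 KA.
suff : \forall t \near 0^'+, pd (K + t *: A).
  move=> h; near ((0 : R)^'+) => t; exists t; last by near: t.
  by near: t; exact: nbhs_right_gt.
apply: near_pd => v /unit_sphere_neq0 v0.
have := K0 v; rewrite le_eqVlt => /orP [/eqP /esym Kv|Kv].
  have Av : \forall v' \near v, 0 < quadform A v'.
    have c : quadform A v' @[v' --> v] --> quadform A v.
      apply: (@cvg_quadform _ _ (nbhs v) _ _ (fun=> A) id) => //.
      exact: cvg_cst.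
    by apply: cvgr_gt c _ _; exact: KA.
  exists ([set v' | 0 < quadform A v'], [set t | 0 < t]) => /=.
    by split=> //; exact: nbhs_right_gt.
  move=> [v' t] /= [Av' t0].
  by rewrite quadform_mxD quadform_mxZ ltr_wpDl // mulr_gt0.
have c : quadform (K + x.2 *: A) x.1 @[x --> (nbhs v, (0 : R)^'+)]
    --> quadform (K + 0 *: A) v.
  apply: cvg_quadform; last exact: cvg_fst.
  apply: cvgD; first exact: cvg_cst.
  apply: cvgZr_tmp.
  exact: (cvg_trans cvg_snd (cvg_within _)).
by apply: cvgr_gt c _ _; rewrite scale0r addr0.
Unshelve. all: by end_near. Qed.

End PositiveDefiniteOpen.

(** * Continuously differentiable maps *)

Set Default Timeout 60.

Section ContinuousDifferentiability.
Context {R : realType}.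
Implicit Types E F : normedModType R.

(** Continuity of the differential is asked only at x itself: this is what
    survives composition and is all that the local surjectivity theorem
    uses. *)
Definition C1_at E F (f : E -> F) (x : E) : Prop :=
  (\forall y \near x, differentiable f y) /\
  forall v, 'd f y v @[y --> x] --> 'd f x v.

Lemma C1_on_at E F (U : set E) (f : E -> F) x :
  open U -> U x -> C1_on U f -> C1_at f x.
Proof.
move=> oU Ux [df cf]; split; last by move=> v; exact: cf.
by near=> y; apply: df; near: y; exact: open_nbhs_nbhs.
Unshelve. all: by end_near. Qed.

Lemma C1_at_diff E F (f : E -> F) x : C1_at f x -> differentiable f x.
Proof. by move=> [/nbhs_singleton]. Qed.

Lemma C1_at_cvg E F (f : E -> F) x : C1_at f x -> f @ x --> f x.
Proof. by move=> /C1_at_diff /differentiable_continuous. Qed.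

Lemma C1_at_is_diff E F (f df : E -> F) x :
  (forall y, is_diff y f df) -> C1_at f x.
Proof.
move=> fdf; split=> [|v]; first by apply: nearW => y; case: (fdf y).
rewrite (_ : (fun y => 'd f y v) = fun=> df v).
  by have -> : 'd f x v = df v; [rewrite diff_val | exact: cvg_cst].
by apply/funext => y; rewrite diff_val.
Qed.

Lemma C1_at_lin E F (L : {linear E -> F}) x : continuous L -> C1_at L x.
Proof.
move=> cL; apply: (@C1_at_is_diff _ _ _ L) => y.
by apply: DiffDef; [exact: linear_differentiable | rewrite diff_lin].
Qed.

Lemma C1_at_cst E F (a : F) (x : E) : C1_at (fun=> a) x.
Proof. exact: (@C1_at_is_diff _ _ _ 0). Qed.

Lemma C1_at_ext E F (f g : E -> F) x : f =1 g -> C1_at f x -> C1_at g x.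
Proof. by move=> /funext ->. Qed.

(** To replace f by a formula for its differential near x, the formula need
    only be valid near x. *)
Lemma C1_at_near_diff E F (f : E -> F) (df : E -> E -> F) x :
  (\forall y \near x, is_diff y f (df y)) ->
  (forall v, df y v @[y --> x] --> df x v) -> C1_at f x.
Proof.
move=> fdf cdf; split; first by apply: filterS fdf => y [].
move=> v; have [_ ->] := nbhs_singleton fdf.
apply: cvg_trans (cdf v); apply: near_eq_cvg.
by apply: filterS fdf => y [_ ->].
Qed.

Lemma C1_atD E F (f g : E -> F) x :
  C1_at f x -> C1_at g x -> C1_at (fun y => f y + g y) x.
Proof.
move=> [df cf] [dg cg].
apply: (@C1_at_near_diff _ _ _
  (fun y => ('d f y : E -> F) + ('d g y : E -> F))).
  near=> y; have fy : differentiable f y by near: y.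
  have gy : differentiable g y by near: y.
  by apply: is_diffD; exact: differentiableP.
by move=> v; apply: cvgD.
Unshelve. all: by end_near. Qed.

Lemma C1_at_sum E F n (f : 'I_n -> E -> F) x :
  (forall i, C1_at (f i) x) -> C1_at (fun y => \sum_i f i y) x.
Proof.
elim: n f => [f _|n IH f fC].
  apply: (@C1_at_ext _ _ (fun=> 0)) => [y|]; first by rewrite big_ord0.
  exact: C1_at_cst.
apply: (@C1_at_ext _ _ (fun y => f ord0 y + \sum_i f (lift ord0 i) y)).
  by move=> y; rewrite big_ord_recl.
by apply: C1_atD => //; exact: IH.
Qed.

Lemma C1_at_lin_comp E F F' (f : E -> F) (L : {linear F -> F'}) x :
  continuous L -> C1_at f x -> C1_at (L \o f) x.
Proof.
move=> cL [df cf].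
apply: (@C1_at_near_diff _ _ _ (fun y => L \o 'd f y)).
  near=> y; have fy : differentiable f y by near: y.
  apply: is_diff_comp; first exact: differentiableP.
  by apply: DiffDef; [exact: linear_differentiable | rewrite diff_lin].
by move=> v; apply: cvg_comp (cf v) (cL _).
Unshelve. all: by end_near. Qed.

Lemma C1_at_comp_lin E E' F (f : E -> F) (L : {linear E' -> E}) x :
  continuous L -> C1_at f (L x) -> C1_at (f \o L) x.
Proof.
move=> cL [df cf].
apply: (@C1_at_near_diff _ _ _ (fun y => 'd f (L y) \o L)).
  near=> y; have fy : differentiable f (L y).
    by near: y; exact: (cL x _ df).
  apply: is_diff_comp; last exact: differentiableP.
  by apply: DiffDef; [exact: linear_differentiable | rewrite diff_lin].
by move=> v; apply: cvg_comp (cf (L v)); exact: cL.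
Unshelve. all: by end_near. Qed.

(** A named constant, so as to carry a linear structure. *)
Definition mx_coord m n i j (M : 'M[R]_(m, n)) : R := M i j.

Lemma mx_coord_linear m n i j : linear (@mx_coord m n i j).
Proof. by move=> a M M'; rewrite /mx_coord !mxE. Qed.

HB.instance Definition _ m n i j := GRing.isLinear.Build R 'M[R]_(m, n) R *%R
  (@mx_coord m n i j) (@mx_coord_linear m n i j).

Lemma C1_at_coord E m n (f : E -> 'M[R]_(m, n)) x i j :
  C1_at f x -> C1_at (fun y => f y i j) x.
Proof.
move=> fC; apply: (C1_at_lin_comp (L := @mx_coord m n i j)) fC.
exact: coord_continuous.
Qed.

Lemma linear_cV_sum n F (L : {linear 'cV[R]_n -> F}) v :
  L v = \sum_j v j 0 *: L (delta_mx j 0).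
Proof.
rewrite [v in L v]matrix_sum_delta linear_sum; apply: eq_bigr => j _.
by rewrite big_ord1 linearZ.
Qed.

(** Pointwise continuity of the differential of g is enough, because R^n is
    finite-dimensional: the differential of g is determined by finitely many
    vectors. *)
Lemma C1_at_comp E n F (f : E -> 'cV[R]_n) (g : 'cV[R]_n -> F) x :
  C1_at f x -> C1_at g (f x) -> C1_at (g \o f) x.
Proof.
move=> fC [dg cg]; have [df cf] := fC.
apply: (@C1_at_near_diff _ _ _ (fun y => 'd g (f y) \o 'd f y)).
  near=> y; have fy : differentiable f y by near: y.
  have gy : differentiable g (f y) by near: y; exact: (C1_at_cvg fC dg).
  by apply: is_diff_comp; exact: differentiableP.
move=> v.
have dgE z w : 'd g z w = \sum_j w j 0 *: 'd g z (delta_mx j 0).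
  exact: linear_cV_sum.
have -> : (fun y => ('d g (f y) \o 'd f y) v) =
    (fun y => \sum_j 'd f y v j 0 *: 'd g (f y) (delta_mx j 0)).
  by apply/funext => y; exact: dgE.
rewrite [X in _ --> X]dgE.
apply: cvg_sumr => j; apply: cvgZ.
  exact: cvg_coord (cf v).
by apply: cvg_comp (cg _); exact: C1_at_cvg.
Unshelve. all: by end_near. Qed.

End ContinuousDifferentiability.

Set Default Timeout 60.

Section BilinearCalculus.
Context {R : realType} {E : normedModType R}.

Section Bilinear.
Context {U V W : normedModType R} (B : {bilinear U -> V -> W}).
Context (B_continuous : continuous (fun p : U * V => B p.1 p.2)).

Lemma is_diff_bilin (f df : E -> U) (g dg : E -> V) x :
  is_diff x f df -> is_diff x g dg ->
  is_diff x (fun y => B (f y) (g y)) (fun v => B (f x) (dg v) + B (df v) (g x)).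
Proof.
move=> fD gD.
have BD : is_diff (f x, g x) (fun p : U * V => B p.1 p.2)
    (fun q => B (f x) q.2 + B q.1 (g x)).
  by apply: DiffDef; [exact: differentiable_bilin | exact: diff_bilin].
have -> : (fun y => B (f y) (g y)) =
  (fun p : U * V => B p.1 p.2) \o (fun y => (f y, g y)) by [].
exact: is_diff_eq.
Qed.

Lemma cvg_bilin T (F : set_system T) {FF : Filter F} (f : T -> U) (g : T -> V)
    (a : U) (b : V) :
  f @ F --> a -> g @ F --> b -> B (f x) (g x) @[x --> F] --> B a b.
Proof.
by move=> fa gb; apply: continuous2_cvg => //; exact: (@B_continuous (a, b)).
Qed.

Lemma C1_at_bilin (f : E -> U) (g : E -> V) x :
  C1_at f x -> C1_at g x -> C1_at (fun y => B (f y) (g y)) x.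
Proof.
move=> fC gC; have [[df cf] [dg cg]] := (fC, gC).
apply: (@C1_at_near_diff _ _ _ _
  (fun y v => B (f y) ('d g y v) + B ('d f y v) (g y))).
  near=> y; have fy : differentiable f y by near: y.
  have gy : differentiable g y by near: y.
  by apply: is_diff_bilin; exact: differentiableP.
move=> v; apply: cvgD; apply: cvg_bilin.
- exact: C1_at_cvg.
- exact: cg.
- exact: cf.
- exact: C1_at_cvg.
Unshelve. all: by end_near. Qed.

End Bilinear.

Lemma scale_bilinear (V : normedModType R) :
  bilinear_for (GRing.Scale.Law.clone _ _ *:%R _)
    (GRing.Scale.Law.clone _ _ *:%R _) (@GRing.scale R V : R^o -> V -> V).
Proof.
split=> [v|k] a x y /=; first by rewrite scalerDl scalerA.
by rewrite scalerDr !scalerA mulrC.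
Qed.

HB.instance Definition _ (V : normedModType R) :=
  bilinear_isBilinear.Build R R^o V V _ _
    (@GRing.scale R V : R^o -> V -> V) (@scale_bilinear V).

Lemma mulmx_bilinear m n p :
  bilinear_for (GRing.Scale.Law.clone _ _ *:%R _)
    (GRing.Scale.Law.clone _ _ *:%R _) (@mulmx R m n p).
Proof.
split=> [v|k] a x y /=; first by rewrite mulmxDl scalemxAl.
by rewrite mulmxDr scalemxAr.
Qed.

HB.instance Definition _ m n p :=
  bilinear_isBilinear.Build R 'M[R]_(m, n) 'M[R]_(n, p) 'M[R]_(m, p) _ _
    (@mulmx R m n p) (@mulmx_bilinear m n p).

Lemma mulmx_continuous m n p :
  continuous (fun q : 'M[R]_(m, n) * 'M[R]_(n, p) => q.1 *m q.2).
Proof. by move=> q; apply: cvg_mulmx; [exact: cvg_fst | exact: cvg_snd]. Qed.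

Lemma is_diff_mulmx m n p (f df : E -> 'M[R]_(m, n)) (g dg : E -> 'M[R]_(n, p))
    x :
  is_diff x f df -> is_diff x g dg ->
  is_diff x (fun y => f y *m g y) (fun v => f x *m dg v + df v *m g x).
Proof. exact: (is_diff_bilin (@mulmx_continuous m n p)). Qed.

Lemma C1_at_mulmx m n p (f : E -> 'M[R]_(m, n)) (g : E -> 'M[R]_(n, p)) x :
  C1_at f x -> C1_at g x -> C1_at (fun y => f y *m g y) x.
Proof. exact: (C1_at_bilin (@mulmx_continuous m n p)). Qed.

Lemma is_diff_scale (V : normedModType R) (f df : E -> R) (g dg : E -> V) x :
  is_diff x f df -> is_diff x g dg ->
  is_diff x (fun y => f y *: g y) (fun v => f x *: dg v + df v *: g x).
Proof. exact: (is_diff_bilin (@scale_continuous R V)). Qed.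

Lemma C1_at_scale (V : normedModType R) (f : E -> R) (g : E -> V) x :
  C1_at f x -> C1_at g x -> C1_at (fun y => f y *: g y) x.
Proof. exact: (C1_at_bilin (@scale_continuous R V)). Qed.

Lemma is_diff_sum (F : normedModType R) n (f df : 'I_n -> E -> F) x :
  (forall i, is_diff x (f i) (df i)) ->
  is_diff x (fun y => \sum_i f i y) (fun v => \sum_i df i v).
Proof.
elim: n f df => [f df _|n IH f df fD].
  have -> : (fun y => \sum_i f i y) = cst 0.
    by apply/funext => y; rewrite big_ord0.
  by apply: is_diff_eq; apply/funext => y; rewrite big_ord0.
have -> : (fun y => \sum_i f i y) =
    f ord0 + (fun y => \sum_i f (lift ord0 i) y).
  by apply/funext => y; rewrite big_ord_recl.
have ? := IH (fun i => f (lift ord0 i)) (fun i => df (lift ord0 i))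
  (fun i => fD _).
by apply: is_diff_eq; apply/funext => y; rewrite big_ord_recl.
Qed.

End BilinearCalculus.

Set Default Timeout 60.

Section StackedMaps.
Context {R : realType} {E : normedModType R} {p N : nat}.

Lemma is_diff_col_mx (f df : E -> 'cV[R]_p) (g dg : E -> 'cV[R]_N) x :
  is_diff x f df -> is_diff x g dg ->
  is_diff x (fun y => col_mx (f y) (g y)) (fun v => col_mx (df v) (dg v)).
Proof.
move=> fD gD.
pose C (y : 'cV[R]_p * 'cV[R]_N) : 'cV[R]_(p + N) := col_mx y.1 y.2.
have C_lin : linear C.
  by move=> a y z; rewrite /C /= -add_col_mx -scale_col_mx.
pose C_isL := GRing.isLinear.Build _ _ _ _ _ C_lin.
pose CL : {linear _ -> _} := HB.pack C C_isL.
have C_cont : continuous CL.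
  move=> y; apply: cvg_mx => i j; rewrite /= /C.
  case: (split_ordP i) => k ->; rewrite ?col_mxEu ?col_mxEd.
    under eq_cvg do rewrite col_mxEu.
    by apply: cvg_coord; exact: cvg_fst.
  under eq_cvg do rewrite col_mxEd.
  by apply: cvg_coord; exact: cvg_snd.
have CD : is_diff (f x, g x) C C.
  by apply: DiffDef; [exact: (@linear_differentiable _ _ _ CL)
                     | exact: (@diff_lin _ _ _ CL)].
have -> : (fun y => col_mx (f y) (g y)) = C \o (fun y => (f y, g y)) by [].
exact: is_diff_eq.
Qed.

Lemma C1_at_col_mx (f : E -> 'cV[R]_p) (g : E -> 'cV[R]_N) x :
  C1_at f x -> C1_at g x -> C1_at (fun y => col_mx (f y) (g y)) x.
Proof.
move=> [df cf] [dg cg].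
apply: (@C1_at_near_diff _ _ _ _ (fun y v => col_mx ('d f y v) ('d g y v))).
  near=> y; have fy : differentiable f y by near: y.
  have gy : differentiable g y by near: y.
  by apply: is_diff_col_mx; exact: differentiableP.
move=> v; apply: cvg_mx => i j.
case: (split_ordP i) => k ->; rewrite ?col_mxEu ?col_mxEd.
  by under eq_cvg do rewrite col_mxEu; exact: cvg_coord (cf v).
by under eq_cvg do rewrite col_mxEd; exact: cvg_coord (cg v).
Unshelve. all: by end_near. Qed.

End StackedMaps.

Section DifferentialLemmas.
Context {R : realType} {E : normedModType R}.

Lemma is_diff_lin_comp (F F' : normedModType R) (L : {linear F -> F'})
    (f df : E -> F) x :
  continuous L -> is_diff x f df -> is_diff x (L \o f) (L \o df).
Proof.
move=> cL fD; apply: is_diff_comp.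
by apply: DiffDef; [exact: linear_differentiable | rewrite diff_lin].
Qed.

Lemma diff_near_eq (F : normedModType R) (f g : E -> F) x v :
  differentiable f x -> differentiable g x ->
  (\forall y \near x, f y = g y) -> 'd f x v = 'd g x v.
Proof.
move=> df dg fg; have [->|v0] := eqVneq v 0; first by rewrite !linear0.
by rewrite -!deriveE // (near_eq_derive (g := g)).
Qed.

Lemma diff_near_cst (F : normedModType R) (f : E -> F) (a : F) x v :
  differentiable f x -> (\forall y \near x, f y = a) -> 'd f x v = 0.
Proof.
move=> df fa; have cd := differentiable_cst a x.
by rewrite (diff_near_eq v df cd fa) diff_cst.
Qed.

Lemma is_diff_quadform N (A dA : E -> 'M[R]_N) (y dy : E -> 'cV[R]_N) x :
  is_diff x A dA -> is_diff x y dy ->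
  is_diff x (fun z => quadform (A z) (y z))
    (fun v => dotv (y x) (A x *m dy v + dA v *m y x) +
              dotv (dy v) (A x *m y x)).
Proof.
move=> AD yD.
have yTD := is_diff_lin_comp (L := @trmx R N 1) (@trmx_continuous R N 1) yD.
have -> : (fun z => quadform (A z) (y z)) =
    @mx_coord R 1 1 0 0 \o (fun z => (y z)^T *m (A z *m y z)).
  by apply/funext => z; rewrite /quadform -mulmxA.
have [fd fE] := is_diff_lin_comp (L := @mx_coord R 1 1 0 0)
  (@coord_continuous R 1 1 0 0) (is_diff_mulmx yTD (is_diff_mulmx AD yD)).
apply: DiffDef; first exact: fd.
by rewrite fE; apply/funext => v; rewrite /= /mx_coord mxE.
Qed.

End DifferentialLemmas.

(** * Local surjectivity *)

Section LocalSurjectivity.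
Context {R : realType}.

Lemma mx_norm_coord m n (M : 'M[R]_(m, n)) i j : `|M i j| <= `|M|.
Proof.
by rewrite [leRHS]/Num.norm /= mx_normrE; exact: (le_bigmax _ _ (i, j)).
Qed.

Lemma mx_norm_le m n (M : 'M[R]_(m, n)) c :
  0 <= c -> (forall i j, `|M i j| <= c) -> `|M| <= c.
Proof.
by move=> c0 Mc; rewrite [leLHS]/Num.norm /= mx_normrE bigmax_le // => -[i j] _.
Qed.

Lemma diff_coord (E : normedModType R) m n (f : E -> 'M[R]_(m, n)) x v i j :
  differentiable f x -> 'd (fun y => f y i j) x v = 'd f x v i j.
Proof.
move=> df; have cC := @coord_continuous R m n i j.
have -> : (fun y => f y i j) = @mx_coord R m n i j \o f by [].
rewrite diff_comp //; last exact: linear_differentiable.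
by rewrite /= diff_lin.
Qed.

Lemma mean_value (E : normedModType R) (f : E -> R) x v :
  (forall t, 0 <= t <= 1 -> differentiable f (x + t *: v)) ->
  exists2 t, 0 <= t <= 1 & f (x + v) - f x = 'd f (x + t *: v) v.
Proof.
move=> df; pose h t := f (x + t *: v).
have lineD (t : R) : is_diff t (fun t : R => x + t *: v) (fun t => t *: v).
  have -> : (fun t : R => x + t *: v) = cst x + *:%R ^~ v by [].
  by apply: is_diff_eq; rewrite add0r.
have hD (t : R) : 0 <= t <= 1 -> is_diff t h ('d f (x + t *: v) \o *:%R ^~ v).
  move=> t01; apply: (@is_diff_comp _ _ _ _ _ _ f) => //.
  exact/differentiableP/df.
have hder : forall t : R, t \in `]0, 1[%R ->
    is_derive t 1 h ('d f (x + t *: v) v).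
  move=> t; rewrite in_itv /= => /andP [t0 t1].
  have ht : is_diff t h ('d f (x + t *: v) \o *:%R ^~ v).
    by apply: hD; rewrite !ltW.
  apply: DeriveDef; first by apply: diff_derivable; case: ht.
  by rewrite deriveE; [case: ht => _ ->; rewrite /= scale1r | case: ht].
have hcont : {within `[0, 1]%classic, continuous h}.
  apply: continuous_in_subspaceT => t; rewrite inE /= in_itv /= => t01.
  by apply: differentiable_continuous; have [] := hD t t01.
have [t] := MVT_segment ler01 hder hcont.
rewrite in_itv /= /h scale1r scale0r addr0 subr0 mulr1 => t01 hE.
by exists t.
Qed.

(* This joins the norm and the completeness of matrices, as the contraction
   principle requires. *)
HB.instance Definition _ m n := NormedModule.on 'M[R]_(m, n).

(** With b_j a preimage of the j-th basis vector under the differential,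
    s |-> s - (g (z0 + sum_j s_j b_j) - y) has differential 0 at the origin, so
    it is a contraction of a small ball when y is close to g z0; its fixed
    point solves g = y. *)
Theorem local_surjectivity (E : normedModType R) n (g : E -> 'cV[R]_n) z0 :
  C1_at g z0 -> (forall w, exists v, 'd g z0 v = w) ->
  forall O, nbhs z0 O -> nbhs (g z0) (g @` O).
Proof.
move=> gC surj O Oz0; pose f i z := g z i 0.
have fC i : C1_at (f i) z0 by exact: C1_at_coord.
have /choice [b bE] : forall j, exists v, forall i, 'd (f i) z0 v = (i == j)%:R.
  move=> j; have [v vE] := surj (delta_mx j 0); exists v => i.
  by rewrite diff_coord ?vE ?mxE ?andbT //; exact: C1_at_diff.
pose L (s : 'cV[R]_n) := \sum_j s j 0 *: b j.
have LD (s s' : 'cV[R]_n) : L (s + s') = L s + L s'.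
  by rewrite /L -big_split; apply: eq_bigr => j _; rewrite mxE scalerDl.
have LZ (t : R) (s : 'cV[R]_n) : L (t *: s) = t *: L s.
  by rewrite /L scaler_sumr; apply: eq_bigr => j _; rewrite mxE scalerA.
pose beta := \sum_j `|b j|.
have beta0 : 0 <= beta by apply: sumr_ge0.
have Lbound s : `|L s| <= beta * `|s|.
  rewrite /beta mulr_suml; apply: le_trans (ler_norm_sum _ _ _) _.
  apply: ler_sum => j _; rewrite normrZ mulrC ler_wpM2l //.
  exact: mx_norm_coord.
(* The coordinates of T s - T s' below are sums of n terms, each bounded by
   delta |s - s'|: this delta makes T 1/2-Lipschitz. *)
pose delta : R := (2 * n.+1%:R)^-1.
have delta0 : 0 < delta by rewrite invr_gt0 mulr_gt0.
have : \forall z \near z0, O z /\ forall i, differentiable (f i) z /\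
    forall j, `|(i == j)%:R - 'd (f i) z (b j)| <= delta.
  apply: filterI => //; apply: filter_forall => i.
  have [df cf] := fC i; apply: filterI => //; apply: filter_forall => j.
  by rewrite -bE; move: delta delta0; apply/cvgrPdist_le; exact: cf.
move=> /nbhs_ballP [rho /= rho0 rhoP].
pose r := rho / (2 * (beta + 1)).
have r0 : 0 < r by rewrite divr_gt0 // mulr_gt0 // ltr_wpDl.
have near_z0 (s : 'cV[R]_n) : `|s| <= r -> ball z0 rho (z0 + L s).
  move=> sr; rewrite -ball_normE /= opprD addNKr normrN.
  apply: le_lt_trans (Lbound s) _.
  apply: (@le_lt_trans _ _ (beta * r)); first by rewrite ler_wpM2l.
  rewrite /r mulrCA gtr_pMr // ltr_pdivrMr ?mulr_gt0 // ?ltr_wpDl //.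
  by move: beta0; clear; lra.
have rhoL (s : 'cV[R]_n) (sr : `|s| <= r) := rhoP _ (near_z0 s sr).
have -> : g z0 = \col_i f i z0 by apply/colP => i; rewrite mxE.
near=> y.
have yr : `|y - \col_i f i z0| <= r / 2.
  near: y; apply: (@cvgr_distC_le _ _ _ _ _ id (\col_i f i z0)).
    exact: cvg_id.
  by rewrite divr_gt0.
pose T (s : 'cV[R]_n) := s - (\col_i f i (z0 + L s) - y).
have T_contracts (s s' : 'cV[R]_n) : `|s| <= r -> `|s'| <= r ->
    `|T s - T s'| <= 2^-1 * `|s - s'|.
  move=> sr s'r; apply: mx_norm_le; first by rewrite mulr_ge0 ?invr_ge0.
  move=> i j; rewrite (ord1 j).
  have segr (t : R) : 0 <= t <= 1 -> `|s' + t *: (s - s')| <= r.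
    move=> /andP [t0 t1].
    have -> : s' + t *: (s - s') = t *: s + (1 - t) *: s'.
      by rewrite scalerBr scalerBl scale1r addrCA.
    apply: le_trans (ler_normD _ _) _.
    rewrite !normrZ (ger0_norm t0) ger0_norm ?subr_ge0 //.
    have -> : r = t * r + (1 - t) * r by ring.
    by rewrite lerD // ler_wpM2l // subr_ge0.
  have [|t t01] := @mean_value _ (f i) (z0 + L s') (L (s - s')).
    move=> t /segr tr; have [_ /(_ i) [+ _]] := rhoL _ tr.
    by rewrite LD LZ addrA.
  have [_ /(_ i) [_ fij]] := rhoL _ (segr t t01).
  rewrite -addrA -LD subrKC -addrA -LZ -LD => fE.
  have -> : (T s - T s') i 0 =
      \sum_j (s - s') j 0 *
        ((i == j)%:R - 'd (f i) (z0 + L (s' + t *: (s - s'))) (b j)).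
    under eq_bigr do rewrite mulrBr.
    rewrite sumrB (bigD1 i) //= eqxx mulr1 big1 ?addr0; last first.
      by move=> k ki; rewrite eq_sym (negbTE ki) mulr0.
    have -> : \sum_j (s - s') j 0 *
        'd (f i) (z0 + L (s' + t *: (s - s'))) (b j) =
        f i (z0 + L s) - f i (z0 + L s').
      rewrite fE /L linear_sum; apply: eq_bigr => k _.
      by rewrite linearZ.
    by rewrite /T !mxE; ring.
  apply: le_trans (ler_norm_sum _ _ _) _.
  apply: (@le_trans _ _ (\sum_(j < n) (delta * `|s - s'|))).
    apply: ler_sum => k _; rewrite normrM mulrC ler_pM //.
    exact: mx_norm_coord.
  rewrite sumr_const card_ord -mulrnAl ler_wpM2r // -mulr_natl /delta.
  rewrite invfM mulrCA ler_piMr ?invr_ge0 // ler_pdivrMr // mul1r.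
  by rewrite ler_nat.
pose U : set 'cV[R]_n := [set s | `|s| <= r].
have U0 : U 0 by rewrite /U /= normr0 ltW.
have T_U s : U s -> U (T s).
  move=> sr; rewrite /U /= -[T s](subrK (T 0)).
  apply: le_trans (ler_normD _ _) _; rewrite [leRHS]splitr lerD //.
    apply: le_trans (T_contracts _ _ sr U0) _.
    by rewrite subr0 mulrC ler_wpM2r ?invr_ge0.
  rewrite /T sub0r opprB.
  have -> : L 0 = 0 by rewrite /L big1 // => j _; rewrite mxE scale0r.
  by rewrite addr0.
have [T' TE] := Pfun T_U.
have [] := @banach_fixed_point _ _ U T'.
- exists (2^-1)%:nng; split; first by rewrite /= invf_lt1 // ltr1n.
  by move=> [s s'] /= [Us Us']; rewrite -TE; exact: T_contracts.
- have -> : U = Num.norm @^-1` [set x | x <= r] by [].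
  apply: closed_comp; last exact: closed_le.
  by move=> s _; exact: norm_continuous.
- by exists 0.
move=> s Us; rewrite -TE /T => sE.
exists (z0 + L s); first by have [] := rhoL s Us.
apply/colP => i; have := congr1 (fun v : 'cV[R]_n => v i 0) sE.
by rewrite !mxE -/(f i (z0 + L s)) => h; lra.
Unshelve. all: by end_near. Qed.

End LocalSurjectivity.

(** * Local solvability of the KKT system *)

Section KKT.
Context {R : realType} {q p N m : nat}.
Context (F : 'cV[R]_q -> 'M[R]_N) (G : 'I_m -> 'cV[R]_q -> 'M[R]_N)
  (c : 'I_m -> 'cV[R]_q -> R) (x : 'cV[R]_q -> 'cV[R]_N)
  (a : 'cV[R]_q -> 'cV[R]_p) (u0 : 'cV[R]_q) (l0 : 'cV[R]_m).
Context (F_C1 : C1_at F u0) (G_C1 : forall i, C1_at (G i) u0)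
  (c_diff : forall i, differentiable (c i) u0)
  (x_C1 : C1_at x u0) (a_C1 : C1_at a u0).

Let mx_of n k (L : 'cV[R]_n -> 'cV[R]_k) : 'M[R]_(k, n) :=
  \matrix_(i, j) L (delta_mx j 0) i 0.

Let mx_ofE n k (L : {linear 'cV[R]_n -> 'cV[R]_k}) v : L v = mx_of L *m v.
Proof.
rewrite linear_cV_sum; apply/colP => i; rewrite summxE mxE.
by apply: eq_bigr => j _; rewrite !mxE mulrC.
Qed.

Let J : 'M[R]_(m, N) := \matrix_(i, j) (G i u0 *m x u0) j 0.
Let H : 'M[R]_N := F u0 + \sum_i l0 i 0 *: G i u0.

Let J_mul w : J *m w = \col_i dotv (G i u0 *m x u0) w.
Proof.
apply/colP => i; rewrite !mxE dotvE; apply: eq_bigr => j _.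
by rewrite [in LHS]mxE.
Qed.

Let JT_mul l : J^T *m l = \sum_i l i 0 *: (G i u0 *m x u0).
Proof.
apply/colP => j; rewrite summxE mxE; apply: eq_bigr => i _.
by rewrite [RHS]mxE mulrC; congr (_ * _); rewrite !mxE.
Qed.

(** If the constraints hold along x, then differentiating them in a direction
    in which the data are stationary leaves only the motion of x. *)
Lemma constraint_tangent v :
  (forall i, (G i u0)^T = G i u0) ->
  (forall i, \forall u \near u0, quadform (G i u) (x u) + c i u = 0) ->
  (forall i, 'd (G i) u0 v = 0 /\ 'd (c i) u0 v = 0) ->
  J *m 'd x u0 v = 0.
Proof.
move=> symG feas stat; rewrite J_mul; apply/colP => i; rewrite !mxE.
have [dG dc] := stat i.
have GD := differentiableP (C1_at_diff (G_C1 i)).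
have xD := differentiableP (C1_at_diff x_C1).
have cD := differentiableP (c_diff i).
have [fd fE] := is_diffD (is_diff_quadform GD xD) cD.
have := diff_near_cst v fd (feas i); rewrite fE !fctE /= dG dc mul0mx !addr0.
rewrite (dotv_sym _ _ (symG i)) dotvC => /eqP.
by rewrite -mulr2n mulrn_eq0 /= => /eqP.
Qed.

(** The unknowns are the parameter u of a feasible pair and the multiplier l;
    the equations prescribe the coordinates a u and ask for stationarity. Their
    differential at (u0, l0) is onto: v0 reaches the prescribed value of a, and
    then a vertical v1 (one that a does not see, so that the data are
    stationary along it) together with l1 corrects the residual of the
    stationarity equation. *)
Lemma kkt_local (O : set ('cV[R]_q * 'cV[R]_m)) :
  (F u0)^T = F u0 -> (forall i, (G i u0)^T = G i u0) ->
  (forall i, \forall u \near u0, quadform (G i u) (x u) + c i u = 0) ->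
  (forall v, 'd a u0 v = 0 -> 'd F u0 v = 0 /\
     forall i, 'd (G i) u0 v = 0 /\ 'd (c i) u0 v = 0) ->
  (forall v, 'd a u0 v = 0 -> 'd x u0 v = 0 -> v = 0) ->
  (N + p <= q + \rank J)%N ->
  H *m x u0 = 0 ->
  (forall w, J *m w = 0 -> quadform H w = 0 -> w = 0) ->
  nbhs (u0, l0) O ->
  nbhs (a u0) [set t | exists2 z, O z & a z.1 = t /\
    (F z.1 + \sum_i z.2 i 0 *: G i z.1) *m x z.1 = 0].
Proof.
move=> symF symG feas stat inj dims Hx HJ Oz.
pose E := ('cV[R]_q * 'cV[R]_m)%type; pose z0 : E := (u0, l0).
have snd_cont : continuous (fun z : E => z.2 : 'cV[R]_m).
  by move=> z; exact: cvg_snd.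
have fst_cont : continuous (fun z : E => z.1 : 'cV[R]_q).
  by move=> z; exact: cvg_fst.
have fstC (V : normedModType R) (f : 'cV[R]_q -> V) :
    C1_at f u0 -> C1_at (fun z : E => f z.1) z0.
  by move=> fC; exact: (C1_at_comp_lin (L := fst) fst_cont).
pose f2 (z : E) := F z.1 *m x z.1 + \sum_i z.2 i 0 *: (G i z.1 *m x z.1).
pose g (z : E) := col_mx (a z.1) (f2 z).
have f2C : C1_at f2 z0.
  apply: C1_atD; first exact: C1_at_mulmx (fstC _ _ F_C1) (fstC _ _ x_C1).
  apply: C1_at_sum => i; apply: C1_at_scale.
    apply: (@C1_at_coord R E m 1 snd).
    exact: (@C1_at_lin R E 'cV[R]_m snd z0 snd_cont).
  exact: C1_at_mulmx (fstC _ _ (G_C1 i)) (fstC _ _ x_C1).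
have gC : C1_at g z0 by apply: C1_at_col_mx => //; exact: fstC.
(* From here on only the values of the differentials matter, so they are
   replaced by matrices and by opaque functions. *)
have [dF [FD dF_vert]] : exists df : 'cV[R]_q -> 'M[R]_N,
    is_diff u0 F df /\ forall v, 'd a u0 v = 0 -> df v = 0.
  exists ('d F u0); split; last by move=> v /stat [].
  exact: (differentiableP (C1_at_diff F_C1)).
have [dG [GD dG_vert]] : exists dg : 'I_m -> 'cV[R]_q -> 'M[R]_N,
    (forall i, is_diff u0 (G i) (dg i)) /\
    forall v, 'd a u0 v = 0 -> forall i, dg i v = 0.
  exists (fun i v => 'd (G i) u0 v); split; last first.
    by move=> v /stat [_ h] i; case: (h i).
  by move=> i; exact: (differentiableP (C1_at_diff (G_C1 i))).
have [||//|a_surj x_ker] := @kernel_dimension_count R q p N m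
    (mx_of ('d a u0)) (mx_of ('d x u0)) J.
- by move=> v; rewrite -!mx_ofE; exact: inj.
- move=> v; rewrite -!mx_ofE => /stat [_ GCv].
  exact: constraint_tangent.
have mxD n k (f : 'cV[R]_n -> 'cV[R]_k) u : differentiable f u ->
    is_diff u f (mulmx (mx_of ('d f u))).
  by move=> df; apply: DiffDef => //; apply/funext => v; exact: mx_ofE.
have aD := mxD _ _ _ _ (C1_at_diff a_C1).
have xD := mxD _ _ _ _ (C1_at_diff x_C1).
have {}dF_vert v : mx_of ('d a u0) *m v = 0 -> dF v = 0.
  by rewrite -mx_ofE; exact: dF_vert.
have {}dG_vert v : mx_of ('d a u0) *m v = 0 -> forall i, dG i v = 0.
  by rewrite -mx_ofE; exact: dG_vert.
move: (mx_of _) (mx_of _) aD xD a_surj x_ker dF_vert dG_vert.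
move=> X A aD xD a_surj x_ker dF_vert dG_vert.
pose df2 (v : E) := F u0 *m (X *m v.1) + dF v.1 *m x u0 +
  \sum_i (l0 i 0 *: (G i u0 *m (X *m v.1) + dG i v.1 *m x u0) +
          v.2 i 0 *: (G i u0 *m x u0)).
have fstD (V : normedModType R) (f df : 'cV[R]_q -> V) :
    is_diff u0 f df -> is_diff z0 (fun z : E => f z.1) (fun v => df v.1).
  move=> fD; apply: (@is_diff_comp _ _ _ _ fst fst f df).
  by apply: DiffDef; [exact: (linear_differentiable (f := fst))
                     | exact: (diff_lin (f := fst))].
have gD : is_diff z0 g (fun v => col_mx (A *m v.1) (df2 v)).
  apply: (is_diff_col_mx (fstD _ _ _ aD)).
  apply: is_diffD; first exact: (is_diff_mulmx (fstD _ _ _ FD) (fstD _ _ _ xD)).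
  apply: is_diff_sum => i; apply: is_diff_scale.
    apply: (@is_diff_comp _ _ _ _ snd snd
      (@mx_coord R m 1 i 0) (@mx_coord R m 1 i 0)).
      by apply: DiffDef; [exact: (linear_differentiable (f := snd))
                         | exact: (diff_lin (f := snd))].
    by apply: DiffDef; [exact/linear_differentiable/coord_continuous
                       | exact/diff_lin/coord_continuous].
  exact: (is_diff_mulmx (fstD _ _ _ (GD i)) (fstD _ _ _ xD)).
have symH : H^T = H.
  rewrite /H linearD /= symF linear_sum; congr (_ + _).
  by apply: eq_bigr => i _; rewrite linearZ /= symG.
have df2_vert v l : A *m v = 0 -> df2 (v, l) = H *m (X *m v) + J^T *m l.
  move=> Av; rewrite /df2 /= (dF_vert v Av) mul0mx addr0 JT_mul /H mulmxDl.
  rewrite mulmx_suml -addrA -big_split; congr (_ + _); apply: eq_bigr => i _.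
  by rewrite (dG_vert v Av) mul0mx addr0 scalemxAl.
have g_surj w : exists v, 'd g z0 v = w.
  have [v0 av0] := a_surj (usubmx w).
  have [w1 [l1 [Jw1 Hw1]]] := kkt_solvable symH HJ (dsubmx w - df2 (v0, 0)).
  have [v1 av1 xv1] := x_ker w1 Jw1.
  exists ((v0, 0) + (v1, l1)); have [_ gdE] := gD.
  rewrite linearD gdE [fst _]/= [fst _]/= av0 av1 add_col_mx addr0.
  by rewrite (df2_vert v1 l1 av1) xv1 Hw1 subrKC vsubmxK.
have gz0 : g z0 = col_mx (a u0) 0.
  rewrite /g /f2 /= -[RHS](congr1 (col_mx _) Hx) /H mulmxDl mulmx_suml.
  by congr (col_mx _ (_ + _)); apply: eq_bigr => i _; rewrite scalemxAl.
have := local_surjectivity gC g_surj Oz; rewrite gz0 => gO.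
have colC : col_mx t (0 : 'cV[R]_N) @[t --> a u0] --> col_mx (a u0) 0.
  apply: (@cvg_mx _ _ (nbhs (a u0))) => i j; case: (split_ordP i) => k ->.
    rewrite col_mxEu; under eq_cvg do rewrite col_mxEu.
    exact: (@coord_continuous R p 1 k j (a u0)).
  by rewrite col_mxEd; under eq_cvg do rewrite col_mxEd; exact: cvg_cst.
have nb : \forall t \near a u0, (g @` O) (col_mx t 0) by exact: colC gO.
apply: filterS nb => t [z Ozz gz]; exists z => //.
have [<- f2z] := eq_col_mx gz; split=> //.
rewrite -[RHS]f2z /f2 mulmxDl mulmx_suml; congr (_ + _).
by apply: eq_bigr => i _; rewrite scalemxAl.
Qed.

End KKT.

(** * Optimality certificates *)

Set Default Timeout 60.

Section PsdDecomposition.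
Context {R : realType} {N : nat}.
Implicit Types (S A : 'M[R]_N) (v w : 'cV[R]_N).

Lemma quadform_delta A i : quadform A (delta_mx i 0) = A i i.
Proof.
rewrite quadform_dotv -colE dotvE (bigD1 i) //= big1 => [|j ji].
  by rewrite !mxE !eqxx mul1r addr0.
by rewrite mxE (negbTE ji) mul0r.
Qed.

Lemma psd_diag_ge0 S i : psd S -> 0 <= S i i.
Proof. by move=> [_ pS]; rewrite -quadform_delta. Qed.

Lemma psd_diag_eq0 S : psd S -> (forall i, S i i = 0) -> S = 0.
Proof.
move=> pS S0; apply/matrixP => i j; rewrite [RHS]mxE.
have : S *m (delta_mx j 0 : 'cV_N) = 0.
  by apply: psd_form_eq0; rewrite ?quadform_delta.
by rewrite -colE => /colP /(_ i); rewrite !mxE.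
Qed.

Lemma psd_outer w : psd (w *m w^T).
Proof.
by split=> [|v]; [rewrite trmx_mul trmxK | rewrite quadform_outer sqr_ge0].
Qed.

(** One step of Cholesky elimination with pivot S i i: the form of the
    remainder at v is that of S at v - (w . v / S i i) e_i. *)
Lemma psd_pivot S i (w := col i S) : psd S -> 0 < S i i ->
  psd (S - (S i i)^-1 *: (w *m w^T)).
Proof.
move=> [sS pS] s0; split=> [|v].
  by rewrite linearB linearZ /= trmx_mul trmxK sS.
have wE : w = S *m delta_mx i 0 by rewrite -colE.
have wv : dotv (delta_mx i 0) (S *m v) = dotv w v.
  by rewrite (dotv_sym _ _ sS) -wE dotvC.
have := pS (v + (- (dotv w v / S i i)) *: delta_mx i 0).
rewrite quadformD // quadformZ quadform_delta -scalemxAr dotvZr -wE.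
rewrite [dotv v w]dotvC.
rewrite quadform_mxD -[- (_ *: (w *m _))]scaleNr quadform_mxZ quadform_outer.
move: (dotv w v) (quadform S v) (S i i) s0 => b r s s0.
suff -> : r + (- (b / s)) ^+ 2 * s + 2 * (- (b / s) * b) = r + - s^-1 * b ^+ 2.
  by [].
by field; rewrite gt_eqF.
Qed.

(** Pivoting on S i i cancels this diagonal entry and keeps the zero ones, since
    a diagonal can only decrease and stays nonnegative: induction on the number
    of nonzero diagonal entries. *)
Lemma psd_sum_outer S : psd S ->
  exists ws : seq 'cV[R]_N, S = \sum_(w <- ws) w *m w^T.
Proof.
have [n] := ubnP #|[pred i | S i i != 0]|; elim: n S => // n IH S Sn pS.
have [/existsP [i Si]|/existsPn S0] := boolP [exists i, S i i != 0]; last first.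
  exists [::]; rewrite big_nil; apply: psd_diag_eq0 => // i.
  by apply/eqP; rewrite -[_ == _]negbK S0.
have s0 : 0 < S i i by rewrite lt_def Si psd_diag_ge0.
set w := col i S; have pS' := psd_pivot pS s0; set S' := S - _ in pS'.
have S'E j : S' j j = S j j - (S i i)^-1 * (S j i) ^+ 2.
  by rewrite !mxE big_ord1 !mxE expr2.
have [|ws S'ws] := IH S' _ pS'.
  apply: (@leq_trans #|[pred i | S i i != 0]|); last exact: Sn.
  apply: proper_card; apply/properP; split.
    apply/fintype.subsetP => j; rewrite !inE; apply: contra => /eqP Sj.
    rewrite eq_le psd_diag_ge0 // S'E Sj sub0r oppr_le0 andbT.
    by rewrite mulr_ge0 ?sqr_ge0 // invr_ge0 ltW.
  exists i; rewrite !inE // negbK S'E expr2 mulrA mulVf // mul1r subrr //.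
exists (Num.sqrt (S i i)^-1 *: w :: ws); rewrite big_cons -S'ws.
rewrite linearZ /= -scalemxAl -scalemxAr scalerA -expr2.
rewrite sqr_sqrtr ?invr_ge0 ?ltW //.
by rewrite /S' addrC subrK.
Qed.

End PsdDecomposition.

Section Certificate.
Context {R : realType} {N m : nat}.
Implicit Types (q : qcqp R N m) (x y : 'cV[R]_N) (S A B : 'M[R]_N).

Lemma ereal_inf_attained T (A : set T) (f : T -> R) a :
  A a -> (forall b, A b -> f a <= f b) ->
  ereal_inf [set (f b)%:E | b in A] = (f a)%:E.
Proof.
move=> Aa fa; apply/eqP; rewrite eq_le; apply/andP; split.
  by apply: ereal_inf_lbound; exists a.
by apply: le_ereal_inf_tmp => _ [b Ab <-]; rewrite lee_fin fa.
Qed.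

Lemma ereal_sup_attained T (A : set T) (f : T -> R) a :
  A a -> (forall b, A b -> f b <= f a) ->
  ereal_sup [set (f b)%:E | b in A] = (f a)%:E.
Proof.
move=> Aa fa; apply/eqP; rewrite eq_le; apply/andP; split.
  by apply: ge_ereal_sup => _ [b Ab <-]; rewrite lee_fin fa.
by apply: ereal_sup_ubound; exists a.
Qed.

Lemma trace_inner_outer A x : trace_inner A (x *m x^T) = quadform A x.
Proof.
rewrite /trace_inner mulmxA mxtrace_mulC mulmxA /mxtrace big_ord1.
by rewrite quadform_dotv dotvC /dotv trmx_mul.
Qed.

Lemma trace_innerDl A B S :
  trace_inner (A + B) S = trace_inner A S + trace_inner B S.
Proof. by rewrite /trace_inner linearD /= mulmxDl linearD. Qed.

Lemma trace_innerZl t A S : trace_inner (t *: A) S = t * trace_inner A S.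
Proof. by rewrite /trace_inner linearZ /= -scalemxAl linearZ. Qed.

Lemma trace_inner_suml (I : finType) (A : I -> 'M[R]_N) S :
  trace_inner (\sum_i A i) S = \sum_i trace_inner (A i) S.
Proof. by rewrite /trace_inner linear_sum /= mulmx_suml linear_sum. Qed.

Lemma trace_inner_sumr (r : seq 'cV[R]_N) A :
  trace_inner A (\sum_(w <- r) w *m w^T) = \sum_(w <- r) quadform A w.
Proof.
rewrite /trace_inner mulmx_sumr linear_sum.
by apply: eq_bigr => w _; exact: trace_inner_outer.
Qed.

Lemma Pfeasible_outer q x : Qfeasible q x -> Pfeasible q (x *m x^T).
Proof.
move=> xq; split=> [|i]; first exact: psd_outer.
by rewrite trace_inner_outer; have /colP /(_ i) := xq; rewrite !mxE.
Qed.

Lemma Pobj_slack q l S : Pfeasible q S ->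
  Pobj q S = trace_inner (slack_mx q l) S + Dobj q l.
Proof.
move=> [_ Sq]; rewrite /slack_mx trace_innerDl trace_inner_suml /Dobj.
rewrite -addrA -big_split /= big1 ?addr0 // => i _.
by rewrite trace_innerZl -mulrDr Sq mulr0.
Qed.

Lemma Qobj_slack q l x : Qfeasible q x ->
  Qobj q x = quadform (slack_mx q l) x + Dobj q l.
Proof.
move=> /Pfeasible_outer /(Pobj_slack l).
by rewrite /Pobj !trace_inner_outer.
Qed.

Lemma psd_trace_ge0 A S : psd A -> psd S -> 0 <= trace_inner A S.
Proof.
move=> [_ pA] /psd_sum_outer [ws ->]; rewrite trace_inner_sumr.
by apply: sumr_ge0 => w _; exact: pA.
Qed.

(** Complementary slackness against a form of corank one determines S up to a
    factor. *)
Lemma psd_trace_eq0 A S x : psd A -> psd S ->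
  (forall v, quadform A v = 0 -> exists t, v = t *: x) ->
  trace_inner A S = 0 -> exists t, S = t *: (x *m x^T).
Proof.
move=> [_ pA] /psd_sum_outer [ws ->] kerA; rewrite trace_inner_sumr.
elim: ws => [_|w ws IH]; first by exists 0; rewrite big_nil scale0r.
rewrite !big_cons => /eqP; rewrite paddr_eq0 ?sumr_ge0 //.
move=> /andP [/eqP /kerA [t ->] /eqP /IH [t' ->]].
exists (t * t + t'); rewrite scalerDl; congr (_ + _).
by rewrite linearZ /= -scalemxAl -scalemxAr scalerA.
Qed.

(** On feasible points the objective is the pairing with the slack matrix plus
    the dual objective, so that H x = 0 and H >= 0 give optimality of x, x x^T
    and l at once. By complementary slackness any other solution is a multiple
    of x x^T (of x), and the constraint with a nonzero constant fixes the
    factor (up to sign). *)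
Lemma kkt_certificate q l x :
  (slack_mx q l)^T = slack_mx q l -> (exists i, con_cst q i <> 0) ->
  Qfeasible q x -> slack_mx q l *m x = 0 ->
  pd (slack_mx q l + x *m x^T) ->
  zero_duality_gap q /\ recovers_minimizer q.
Proof.
set H := slack_mx q l => symH [i0 c0] xq Hx pK.
have con i y : Qfeasible q y -> quadform (con_mx q i) y = - con_cst q i.
  move=> /colP /(_ i); rewrite !mxE => h; apply/eqP.
  by rewrite -addr_eq0 h.
have x0 : x != 0.
  apply/eqP => x0; apply: c0; apply/eqP; rewrite -oppr_eq0 -(con _ _ xq) x0.
  by rewrite quadform_dotv mulmx0 dotvr0.
have pH : psd H by split=> // v; case: (pd_outer_psd v symH Hx x0 pK).
have kerH v : quadform H v = 0 -> exists t, v = t *: x.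
  by case: (pd_outer_psd v symH Hx x0 pK).
have xP := Pfeasible_outer xq.
have xD : Qobj q x = Dobj q l.
  by rewrite (Qobj_slack l xq) quadform_dotv Hx dotvr0 add0r.
have Px : Pobj q (x *m x^T) = Qobj q x by exact: trace_inner_outer.
have P_ge S : Pfeasible q S -> Qobj q x <= Pobj q S.
  by move=> Sq; rewrite (Pobj_slack l Sq) xD lerDr psd_trace_ge0 //; case: Sq.
have Q_ge y : Qfeasible q y -> Qobj q x <= Qobj q y.
  by move=> yq; rewrite (Qobj_slack l yq) xD lerDr; case: pH.
have QE : Qval q = (Qobj q x)%:E by exact: ereal_inf_attained.
have PE : Pval q = (Qobj q x)%:E.
  by rewrite -Px; apply: ereal_inf_attained => // S; rewrite Px; exact: P_ge.
have DE : Dval q = (Qobj q x)%:E.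
  rewrite xD; apply: ereal_sup_attained => // l' [_ pH'].
  by rewrite -xD (Qobj_slack l' xq) lerDr.
split; first by rewrite /zero_duality_gap QE PE DE.
have scale_sq t :
    quadform (con_mx q i0) (t *: x) = - con_cst q i0 -> t ^+ 2 = 1.
  rewrite quadformZ con // mulrN => /oppr_inj.
  by rewrite -[RHS]mul1r; apply: mulIf; exact/eqP.
exists x; split=> [y|S]; split.
- move=> [yq /(_ x xq) yx].
  have : quadform H y = 0.
    apply/eqP; rewrite eq_le; case: pH => _ ->; rewrite andbT.
    by move: yx; rewrite (Qobj_slack l yq) xD gerDr.
  move=> /kerH [t yE]; have := scale_sq t.
  rewrite -yE con // => /(_ erefl) /eqP.
  rewrite sqrf_eq1 yE => /orP [] /eqP ->; first by left; rewrite scale1r.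
  by right; rewrite scaleN1r.
- have NE A : quadform A (- x) = quadform A x.
    by rewrite -scaleN1r quadformZ sqrrN expr1n mul1r.
  move=> [->|->]; split=> //; last by move=> z /Q_ge; rewrite /Qobj NE.
  by apply: etrans xq; apply/colP => i; rewrite !mxE NE.
- move=> [Sq /(_ _ xP) Sx].
  have [t SE] : exists t, S = t *: (x *m x^T).
    apply: (psd_trace_eq0 pH (proj1 Sq) kerH); apply/eqP; rewrite eq_le.
    rewrite (psd_trace_ge0 pH (proj1 Sq)) andbT.
    by move: Sx; rewrite Px (Pobj_slack l Sq) xD gerDr.
  suff t1 : t = 1 by rewrite SE t1 scale1r.
  have := proj2 Sq i0; rewrite SE /trace_inner -scalemxAr linearZ /=.
  rewrite -/(trace_inner _ _) trace_inner_outer con // mulrN => /eqP.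
  rewrite addrC subr_eq0 => /eqP h; apply: (mulIf (x := con_cst q i0)).
    exact/eqP.
  by rewrite mul1r -h.
- move=> ->; split=> // S' /P_ge; by rewrite Px.
Qed.

End Certificate.

(** * The certificate at the reference parameter *)

Set Default Timeout 60.

Section ConstraintDerivatives.
Context {R : realType} {N m : nat}.
Implicit Types (q : qcqp R N m) (x v : 'cV[R]_N) (A : 'M[R]_N).

Lemma derive_quadform A c x v : A^T = A ->
  'D_v (fun y => quadform A y + c) x = 2 * dotv (A *m x) v.
Proof.
move=> sA.
have qD := is_diffD
  (is_diff_quadform (is_diff_cst A x) (is_diff_id x)) (is_diff_cst c x).
have [fd fE] := qD.
rewrite deriveE //; rewrite fE !fctE /= mul0mx !addr0.
by rewrite (dotv_sym _ _ sA) [dotv v _]dotvC mulr_natl mulr2n.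
Qed.

Lemma jacobian_con_fun q x : (forall i, (con_mx q i)^T = con_mx q i) ->
  jacobian_mx (con_fun q) x = 2 *: \matrix_(i, j) (con_mx q i *m x) j 0.
Proof.
move=> symG; apply/matrixP => i j; rewrite !mxE.
have -> : (fun y => con_fun q y i 0) =
    (fun y => quadform (con_mx q i) y + con_cst q i).
  by apply/funext => y; rewrite !mxE.
rewrite derive_quadform // dotvC dotvE (bigD1 j) //= big1 ?addr0 => [|k kj].
  by rewrite !mxE !eqxx mul1r.
by rewrite mxE (negbTE kj) mul0r.
Qed.

Lemma slack_sym q l : (obj_mx q)^T = obj_mx q ->
  (forall i, (con_mx q i)^T = con_mx q i) -> (slack_mx q l)^T = slack_mx q l.
Proof.
move=> sF sG; rewrite /slack_mx linearD /= sF linear_sum; congr (_ + _).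
by apply: eq_bigr => i _; rewrite linearZ /= sG.
Qed.

(** The function of the Slater condition is a quadratic form up to a constant,
    so that strict convexity on a subspace is positivity on it, and criticality
    of x is the vanishing of A x. *)
Lemma restricted_SlaterP q x l : (forall i, (con_mx q i)^T = con_mx q i) ->
  restricted_Slater q x l ->
  exists l' : 'cV[R]_m, let A := \sum_i l' i 0 *: con_mx q i in
    A *m x = 0 /\
    forall v, v != 0 -> slack_mx q l *m v = 0 -> dotv x v = 0 ->
      0 < quadform A v.
Proof.
move=> sG [l' [convex grad]]; exists l'; set A := \sum_i _ => /=.
have sA : A^T = A.
  by rewrite linear_sum; apply: eq_bigr => i _; rewrite linearZ /= sG.
pose e := \sum_i l' i 0 * con_cst q i.
have PsiE : (fun y => \sum_i l' i 0 * con_fun q y i 0) =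
    (fun y => quadform A y + e).
  apply/funext => y; rewrite quadform_mxsum -big_split; apply: eq_bigr => i _.
  by rewrite mxE mulrDr quadform_mxZ.
move: convex grad; rewrite PsiE => convex grad; split.
  apply/colP => j; rewrite [RHS]mxE; have /colP /(_ j) := grad.
  rewrite !mxE derive_quadform // dotvC dotvE (bigD1 j) //= big1 => [|k kj].
    rewrite mxE !eqxx mul1r addr0 mxE => /eqP.
    by rewrite mulf_eq0 pnatr_eq0 /= => /eqP.
  by rewrite mxE (negbTE kj) mul0r.
move=> v v0 Hv xv.
(* v and - v are two points of the subspace with midpoint 0 *)
have xv0 : x^T *m v = 0 by rewrite [LHS]mx11_scalar -/(dotv x v) xv raddf0.
have half01 : (0 : R) < (2^-1 : R) < (1 : R).
  by rewrite invr_gt0 ltr0n invf_lt1 // ltr1n.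
have vNv : v <> - v.
  move=> /eqP; rewrite -addr_eq0 -mulr2n -scaler_nat scaler_eq0.
  by rewrite pnatr_eq0 (negbTE v0).
have := convex v (- v) 2^-1 (conj Hv xv0) _ vNv half01.
rewrite /= !mulmxN Hv xv0 !oppr0 => /(_ (conj erefl erefl)).
have -> : 2^-1 *: v + (1 - 2^-1) *: - v = 0.
  rewrite scalerN -scalerBl; have -> : 2^-1 - (1 - 2^-1) = 0 :> R by lra.
  by rewrite scale0r.
have -> : quadform A (- v) = quadform A v.
  by rewrite -scaleN1r quadformZ sqrrN expr1n mul1r.
have -> : quadform A 0 = 0 by rewrite quadform_dotv mulmx0 dotvr0.
by rewrite -mulrDl subrKC mul1r add0r ltrDr.
Qed.

(** Zero gap between optimal x and l means that the form of the slack matrix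
    vanishes at x. *)
Lemma gap_complementarity q x l :
  zero_duality_gap q -> Qopt q x -> Dopt q l -> slack_mx q l *m x = 0.
Proof.
move=> [QP PD] [xq x_min] [lq l_max]; apply: psd_form_eq0 => //.
have : (Qobj q x)%:E = (Dobj q l)%:E :> \bar R.
  rewrite -(ereal_inf_attained xq x_min) -(ereal_sup_attained lq l_max).
  exact: etrans QP PD.
move=> [] /eqP; rewrite (Qobj_slack l xq) -subr_eq0 addrK => /eqP.
by [].
Qed.

End ConstraintDerivatives.

Set Default Timeout 60.

(** The form of slack_mx q l + x x^T is nonnegative and vanishes on the subspace
    of the Slater condition, where A is positive; so a small multiple of A makes
    it positive definite, without moving x out of the kernel. *)
Lemma corank_one_multiplier (R : realType) (N m : nat) (q : qcqp R N m)
    (x : 'cV[R]_N) (l : 'cV[R]_m) :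
  (forall i, (con_mx q i)^T = con_mx q i) ->
  zero_duality_gap q -> Qopt q x -> Dopt q l -> restricted_Slater q x l ->
  exists l', slack_mx q l' *m x = 0 /\ pd (slack_mx q l' + x *m x^T).
Proof.
move=> symG gap xopt lopt /(restricted_SlaterP symG) [l' [Ax0 A_pd]].
set A := \sum_i _ in Ax0 A_pd; have Hx := gap_complementarity gap xopt lopt.
have [pH _] := lopt; rewrite /Dfeasible /= in pH.
have [|v v0|t _ pt] := @debreu R N (slack_mx q l + x *m x^T) A.
- move=> v; rewrite quadform_mxD quadform_outer addr_ge0 ?sqr_ge0 //.
  by case: pH.
- rewrite quadform_mxD quadform_outer => /eqP.
  rewrite paddr_eq0 ?sqr_ge0 //; last by case: pH.
  move=> /andP [/eqP Hv]; rewrite sqrf_eq0 => /eqP xv.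
  by apply: A_pd => //; exact: psd_form_eq0.
exists (l + t *: l').
have -> : slack_mx q (l + t *: l') = slack_mx q l + t *: A.
  rewrite /slack_mx -addrA; congr (_ + _).
  rewrite /A scaler_sumr -big_split; apply: eq_bigr => i _ /=.
  by rewrite !mxE scalerDl scalerA.
split; first by rewrite mulmxDl Hx -scalemxAl Ax0 scaler0 addr0.
by rewrite addrAC.
Qed.

(** * Charts of submanifolds *)

Section Charts.
Context {R : realType}.

Lemma left_inverse_diff (E F : normedModType R) (f : E -> F) (g : F -> E) x v :
  differentiable f x -> differentiable g (f x) ->
  (\forall y \near x, g (f y) = y) -> 'd f x v = 0 -> v = 0.
Proof.
move=> df dg gf fv; have gfd : differentiable (g \o f) x.
  exact: differentiable_comp.
have [idd idE] := is_diff_id x.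
have := diff_near_eq v gfd idd gf.
by rewrite diff_comp //= fv linear0 idE => <-.
Qed.

(** P is the inverse chart restricted to R^q * 0; the chart is a left inverse of
    it, which makes its differential injective. *)
Lemma manifold_param (E : normedModType R) (M : set E) w q :
  manifold_near M w q ->
  exists (P : 'cV[R]_q -> E) u0,
    [/\ P u0 = w, C1_at P u0, forall v, 'd P u0 v = 0 -> v = 0
      & \forall u \near u0, M (P u)].
Proof.
move=> [Mw [c [U [V [phi [psi [[oU Uw] oV [phiC psiC] [UV VU] MU]]]]]]].
pose i0 (u : 'cV[R]_q) : 'cV[R]_q * 'cV[R]_c := (u, 0).
have i0_lin : linear i0.
  by move=> a u v; rewrite /i0 -[RHS]/(_, _) /= scaler0 addr0.
pose i0_isL := GRing.isLinear.Build _ _ _ _ _ i0_lin.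
pose i0L : {linear _ -> _} := HB.pack i0 i0_isL.
have i0_cont : continuous i0L.
  move=> u; have [i0d _] := is_diff_pair (is_diff_id u)
    (is_diff_cst (0 : 'cV[R]_c) u).
  exact: differentiable_continuous i0d.
have phiw : i0 (phi w).1 = phi w.
  by rewrite /i0 -(proj1 (MU w Uw) Mw); case: (phi w).
have Vw : V (phi w) by case: (UV w Uw).
have psiw : psi (phi w) = w by case: (UV w Uw).
have near_V : \forall u \near (phi w).1, V (i0 u).
  by apply: i0_cont; rewrite /= phiw; exact: open_nbhs_nbhs.
have PC : C1_at (psi \o i0L) (phi w).1.
  by apply: C1_at_comp_lin => //; rewrite /= phiw; exact: C1_on_at psiC.
exists (psi \o i0), (phi w).1; split => //=.
- by rewrite phiw.
- move=> v Pv.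
  have : i0 v = 0.
    apply: (left_inverse_diff (f := psi) (g := phi) (x := phi w)).
    + by case: psiC => h _; exact: h.
    + by rewrite psiw; case: phiC => h _; exact: h.
    + near=> z; have Vz : V z by near: z; exact: open_nbhs_nbhs.
      by case: (VU z Vz).
    + have i0d : differentiable i0L (phi w).1 by exact: linear_differentiable.
      have psid : differentiable psi (i0L (phi w).1).
        by rewrite /= phiw; case: psiC => h _; exact: h.
      have i0E : 'd i0L ((phi w).1) = i0 :> (_ -> _) by exact: diff_lin.
      by rewrite -Pv (diff_comp i0d psid) i0E /= phiw.
  by case.
- near=> u; have Vu : V (i0 u) by near: u.
  have [Uu phiu] := VU _ Vu.
  by apply/(MU _ Uu); rewrite phiu.
Unshelve. all: by end_near. Qed.

(** f is the first component of the chart. The second one vanishes along M, so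
    that f alone separates the points of M and detects the motions h inside
    M. *)
Lemma manifold_coord (E : normedModType R) (M : set E) w p :
  manifold_near M w p ->
  exists (f : E -> 'cV[R]_p) (U : set E),
    [/\ C1_at f w, nbhs w U,
      forall y z, U y -> U z -> M y -> M z -> f y = f z -> y = z
      & forall q (h : 'cV[R]_q -> E) u v, h u = w -> differentiable h u ->
          (\forall t \near u, M (h t)) -> 'd (f \o h) u v = 0 -> 'd h u v = 0].
Proof.
move=> [Mw [c [U [V [phi [psi [[oU Uw] oV [phiC psiC] [UV VU] MU]]]]]]].
have fstc : continuous (fun z : 'cV[R]_p * 'cV[R]_c => z.1 : 'cV[R]_p).
  by move=> z; exact: cvg_fst.
have sndc : continuous (fun z : 'cV[R]_p * 'cV[R]_c => z.2 : 'cV[R]_c).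
  by move=> z; exact: cvg_snd.
have phi_at : C1_at phi w by exact: C1_on_at phiC.
have phid := C1_at_diff phi_at.
exists (fst \o phi), U; split.
- exact: (C1_at_lin_comp (L := fst)).
- exact: open_nbhs_nbhs.
- move=> y z Uy Uz My Mz yz.
  have [_ <-] := UV y Uy; have [_ <-] := UV z Uz; congr psi.
  have y2 := proj1 (MU y Uy) My; have z2 := proj1 (MU z Uz) Mz.
  move: yz y2 z2 => /=.
  by case: (phi y) => ? ?; case: (phi z) => ? ? /= -> -> ->.
- move=> q h u v hu hd Mh fhv.
  have phid' : differentiable phi (h u) by rewrite hu.
  apply: (left_inverse_diff (f := phi) (g := psi) (x := h u)) => //.
  + by rewrite hu; case: psiC => psid _; apply: psid; case: (UV w Uw).
  + rewrite hu; near=> y; have Uy : U y by near: y; exact: open_nbhs_nbhs.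
    by case: (UV y Uy).
  + have phihd : differentiable (phi \o h) u by exact: differentiable_comp.
    have e1 : ('d (phi \o h) u v).1 = 0.
      rewrite -fhv (@diff_comp _ _ _ _ (phi \o h) fst) //=.
        by rewrite (diff_lin (f := fst)).
      exact: (linear_differentiable (f := fst)).
    have e2 : ('d (phi \o h) u v).2 = 0.
      have sphid : differentiable (snd \o (phi \o h)) u.
        apply: differentiable_comp => //.
        exact: (linear_differentiable (f := snd)).
      have : 'd (snd \o (phi \o h)) u v = 0.
        apply: (diff_near_cst (a := 0)) => //.
        near=> t; have Mt : M (h t) by near: t.
        have Ut : U (h t).
          near: t; apply: (differentiable_continuous hd); rewrite hu.
          exact: open_nbhs_nbhs.
        by rewrite /= (proj1 (MU _ Ut) Mt).
      rewrite (@diff_comp _ _ _ _ (phi \o h) snd) //=.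
        by rewrite (diff_lin (f := snd)).
      exact: (linear_differentiable (f := snd)).
    have : 'd (phi \o h) u v = 0.
      by move: e1 e2; case: ('d (phi \o h) u v) => ? ? /= -> ->.
    by rewrite diff_comp.
Unshelve. all: by end_near. Qed.

Lemma C1_along_at (E F : normedModType R) (M : set E) (f : E -> F) x :
  C1_along M f -> M x ->
  exists g : E -> F, C1_at g x /\ \forall y \near x, M y -> g y = f y.
Proof.
move=> fC Mx; have [U [g [oU Ux gC gf]]] := fC x Mx.
exists g; split; first exact: C1_on_at gC.
by near=> y => My; apply: gf => //; near: y; exact: open_nbhs_nbhs.
Unshelve. all: by end_near. Qed.

End Charts.

(** * Stability *)

Theorem theorem4p5 (R : realType) (d N m p : nat)
  (Theta : set 'cV[R]_d)
  (F : 'cV[R]_d -> 'M[R]_N)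
  (G : 'I_m -> 'cV[R]_d -> 'M[R]_N)
  (c : 'I_m -> 'cV[R]_d -> R)
  (Q := fun theta => QCQP (F theta) (G^~ theta) (c^~ theta))
  (Theta_manifold : submanifold Theta p)
  (F_sym : forall theta, Theta theta -> (F theta)^T = F theta)
  (G_sym : forall i theta, Theta theta -> (G i theta)^T = G i theta)
  (F_C1 : C1_along Theta F)
  (G_C1 : forall i, C1_along Theta (G i))
  (c_C1 : forall i, C1_along Theta (c i))
  (c_neq0 : forall theta, Theta theta -> exists i, c i theta <> 0)
  (thetab : 'cV[R]_d) (xb : 'cV[R]_N) (lb : 'cV[R]_m)
  (thetab_in : Theta thetab)
  (thetab_gap : zero_duality_gap (Q thetab))
  (xb_opt : Qopt (Q thetab) xb)
  (lb_opt : Dopt (Q thetab) lb)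
  (Hb := slack_mx (Q thetab) lb)
  (acq : ACQ (Q thetab) xb)
  (smooth : feasible_smooth_near Theta p Q thetab xb)
  (non_branch : ~ branch_point (Q thetab) (mulmx Hb) xb)
  (slater : restricted_Slater (Q thetab) xb lb) :
  SDP_stable_near Theta Q thetab /\
  near_in Theta thetab (fun theta => recovers_minimizer (Q theta)).
Proof.
(* k is the dimension of the feasible set in ACQ and, through the smoothness
   hypothesis, p + k is that of the graph. *)
move: acq => [_]; set k := local_dim _ xb => rkJ.
move: smooth => [/(xgetPex 0%N) + dimW]; rewrite -/(local_dim _ _) dimW -/k.
move=> /manifold_param [P [u0 [Pu0 P_C1 P_imm P_in]]].
have [crd [U [crd_C1 nU crd_inj crd_imm]]] :=
  manifold_coord (Theta_manifold _ thetab_in).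
(* The data are known on Theta only; F', G', c' are C^1 in the ambient space. *)
have [F' [F'_C1 F'_F]] := C1_along_at F_C1 thetab_in.
have /choice [G' G'P] i := C1_along_at (G_C1 i) thetab_in.
have /choice [c' c'P] i := C1_along_at (c_C1 i) thetab_in.
have symF : (obj_mx (Q thetab))^T = obj_mx (Q thetab) by exact: F_sym.
have symG i : (con_mx (Q thetab) i)^T = con_mx (Q thetab) i by exact: G_sym.
have [l0 [Hx pK]] := corank_one_multiplier symG thetab_gap xb_opt lb_opt slater.
have xb_feas : Qfeasible (Q thetab) xb by case: xb_opt.
pose th u := (P u).1; pose x u := (P u).2.
have th0 : th u0 = thetab by rewrite /th Pu0.
have x0 : x u0 = xb by rewrite /x Pu0.
have th_C1 : C1_at th u0.
  by apply: (C1_at_lin_comp (L := fst)) => // z; exact: cvg_fst.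
have x_C1 : C1_at x u0.
  by apply: (C1_at_lin_comp (L := snd)) => // z; exact: cvg_snd.
have th_near A : nbhs thetab A -> \forall u \near u0, A (th u).
  by move=> nA; apply: (C1_at_cvg th_C1); rewrite th0.
have compC1 (E : normedModType R) (f : 'cV[R]_d -> E) :
    C1_at f thetab -> C1_at (f \o th) u0.
  by rewrite -th0 => fC; exact: (C1_at_comp th_C1 fC).
pose a := crd \o th.
have a_C1 : C1_at a u0 by exact: compC1.
have data_near : \forall t \near thetab, U t /\ (Theta t -> [/\ F' t = F t,
    forall i, G' i t = G i t & forall i, c' i t = c i t]).
  have nG : \forall t \near thetab, forall i, Theta t -> G' i t = G i t.
    exact: (filter_forall _ (fun i => proj2 (G'P i))).
  have nc : \forall t \near thetab, forall i, Theta t -> c' i t = c i t.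
    exact: (filter_forall _ (fun i => proj2 (c'P i))).
  apply: filterS (filterI nU (filterI F'_F (filterI nG nc))).
  by move=> t [Ut [Ft [Gt ct]]]; split=> // Tt; split=> [|i|i]; auto.
pose good u := [/\ Theta (th u), Qfeasible (Q (th u)) (x u), U (th u)
  & [/\ F' (th u) = F (th u), forall i, G' i (th u) = G i (th u)
      & forall i, c' i (th u) = c i (th u)]].
have good_near : \forall u \near u0, good u.
  have h := th_near _ data_near.
  apply: filterS (filterI h P_in) => u [[Uu data] [Tu xu]].
  by split=> //; exact: data.
have [_ _ _ [F'0 G'0 c'0]] : good u0 := nbhs_singleton good_near.
have slackE t (l : 'cV[R]_m) : [/\ F' t = F t, forall i, G' i t = G i t
    & forall i, c' i t = c i t] ->
    F' t + \sum_i l i 0 *: G' i t = slack_mx (Q t) l.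
  move=> [-> GE _]; rewrite /slack_mx; congr (_ + _).
  by apply: eq_bigr => i _; rewrite GE.
pose J := \matrix_(i, j) (G' i (th u0) *m x u0) j 0.
have JE : J = \matrix_(i, j) (con_mx (Q thetab) i *m xb) j 0.
  by apply/matrixP => i j; rewrite mxE [RHS]mxE G'0 th0 x0.
have stat v : 'd a u0 v = 0 -> 'd th u0 v = 0.
  apply: crd_imm => //; first exact: C1_at_diff.
  by apply: filterS good_near => u [].
have comp_stat (E : normedModType R) (f : 'cV[R]_d -> E) v :
    C1_at f thetab -> 'd a u0 v = 0 -> 'd (f \o th) u0 v = 0.
  move=> fC /stat thv.
  have fd : differentiable f (th u0) by rewrite th0; exact: C1_at_diff.
  by rewrite (diff_comp (C1_at_diff th_C1) fd) /= thv linear0.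
have x_imm v : 'd a u0 v = 0 -> 'd x u0 v = 0 -> v = 0.
  move=> /stat thv xv; apply: P_imm; have Pd := C1_at_diff P_C1.
  have : 'd (fst \o P) u0 v = 0 by exact: thv.
  have : 'd (snd \o P) u0 v = 0 by exact: xv.
  have sd : differentiable (snd : 'cV[R]_d * 'cV[R]_N -> 'cV[R]_N) (P u0).
    by apply: (linear_differentiable (f := snd)) => z; exact: cvg_snd.
  have fd : differentiable (fst : 'cV[R]_d * 'cV[R]_N -> 'cV[R]_d) (P u0).
    by apply: (linear_differentiable (f := fst)) => z; exact: cvg_fst.
  rewrite (diff_comp Pd sd) (diff_comp Pd fd) /=.
  rewrite (diff_lin (f := snd)); last by move=> z; exact: cvg_snd.
  rewrite (diff_lin (f := fst)); last by move=> z; exact: cvg_fst.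
  by case: ('d P u0 v) => ? ? /= -> ->.
have xb0 : xb != 0.
  apply/eqP => xb0; have [i] := c_neq0 thetab thetab_in; apply.
  have /colP /(_ i) := xb_feas.
  by rewrite !mxE xb0 quadform_dotv mulmx0 dotvr0 add0r.
have ker_form w : J *m w = 0 ->
    quadform (slack_mx (Q thetab) l0) w = 0 -> w = 0.
  move=> Jw qw.
  have [_ /(_ qw) [t wE]] := pd_outer_psd w (slack_sym l0 symF symG) Hx xb0 pK.
  have [i ci] := c_neq0 thetab thetab_in.
  have /colP /(_ i) := xb_feas; rewrite !mxE /= => gi.
  have /colP /(_ i) := Jw; rewrite JE wE -scalemxAr !mxE.
  have -> : \sum_j (\matrix_(i, j) (con_mx (Q thetab) i *m xb) j 0) i j * xb j 0
      = quadform (G i thetab) xb.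
    rewrite quadform_dotv dotvC dotvE; apply: eq_bigr => j _.
    by rewrite [X in X * _]mxE.
  move=> /eqP; rewrite mulf_eq0 => /orP [/eqP ->|/eqP q0].
    by rewrite scale0r.
  by case: ci; rewrite -gi q0 add0r.
(* The truncated subtraction in ACQ is harmless: N <= k + (N - k) always. *)
have dims : (N + p <= (p + k) + \rank J)%N.
  have -> : \rank J = (N - k)%N.
    by rewrite -rkJ jacobian_con_fun // JE mxrank_scale_nz // pnatr_eq0.
  by lia.
pose O := [set z : 'cV[R]_(p + k) * 'cV[R]_m | good z.1 /\
  pd (F' (th z.1) + \sum_i z.2 i 0 *: G' i (th z.1) + x z.1 *m (x z.1)^T)].
have K0E : F' (th u0) + \sum_i l0 i 0 *: G' i (th u0) = slack_mx (Q thetab) l0.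
  by rewrite slackE // th0.
have nO : nbhs (u0, l0) O.
  apply: filterI.
    exact: (@cvg_fst _ _ (nbhs u0) (nbhs l0) _ _ good_near).
  have cu (V : normedModType R) (f : 'cV[R]_(p + k) -> V) : C1_at f u0 ->
      f z.1 @[z --> filter_prod (nbhs u0) (nbhs l0)] --> f u0.
    by move=> /C1_at_cvg; apply: cvg_comp; exact: cvg_fst.
  pose K (z : 'cV[R]_(p + k) * 'cV[R]_m) :=
    F' (th z.1) + \sum_i z.2 i 0 *: G' i (th z.1) + x z.1 *m (x z.1)^T.
  have : K @ filter_prod (nbhs u0) (nbhs l0) -->
      slack_mx (Q thetab) l0 + xb *m xb^T; last exact: cvg_near_pd pK.
  rewrite -K0E -x0; apply: cvgD; last first.
    by apply: cvg_mulmx; [exact: cu|apply: cvg_trmx; exact: cu].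
  apply: cvgD; first exact: (cu _ _ (compC1 _ _ F'_C1)).
  apply: cvg_sumr => i; apply: cvgZ.
    by apply: cvg_coord; exact: cvg_snd.
  exact: (cu _ _ (compC1 _ _ (proj1 (G'P i)))).
have feas i : \forall u \near u0,
    quadform (G' i (th u)) (x u) + c' i (th u) = 0.
  apply: filterS good_near => u [_ /colP /(_ i) + _ [_ -> ->]].
  by rewrite !mxE.
have sol := @kkt_local R (p + k) p N m (F' \o th) (fun i => G' i \o th)
  (fun i => c' i \o th) x a u0 l0 (compC1 _ _ F'_C1)
  (fun i => compC1 _ _ (proj1 (G'P i)))
  (fun i => C1_at_diff (compC1 _ _ (proj1 (c'P i)))) x_C1 a_C1 O.
have {}sol : nbhs (a u0) [set t | exists2 z, O z & a z.1 = t /\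
    (F' (th z.1) + \sum_i z.2 i 0 *: G' i (th z.1)) *m x z.1 = 0].
  apply: sol => //=.
  - by rewrite F'0 th0; exact: F_sym.
  - by move=> i; rewrite G'0 th0; exact: G_sym.
  - move=> v av; split; first exact: (comp_stat _ _ _ F'_C1 av).
    move=> i; split; first exact: (comp_stat _ _ _ (proj1 (G'P i)) av).
    exact: (comp_stat _ _ _ (proj1 (c'P i)) av).
  - by rewrite K0E x0.
  - by rewrite K0E.
suff : \forall t \near within Theta (nbhs thetab),
    zero_duality_gap (Q t) /\ recovers_minimizer (Q t).
  by move=> h; split; apply: filterS h => t [].
have crd_near : \forall t \near thetab, exists2 z, O z & a z.1 = crd t /\
    (F' (th z.1) + \sum_i z.2 i 0 *: G' i (th z.1)) *m x z.1 = 0.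
  have a0 : a u0 = crd thetab by rewrite /a /= th0.
  by move: sol; rewrite a0 => sol; exact: (C1_at_cvg crd_C1 sol).
apply: filterS (filterI nU crd_near).
move=> t [Ut [[u l] [[/= Tu xu Uu data] pKu] [/= au Hxu]]] Tt.
(* theta(u) and t are two points of Theta with the same coordinates. *)
have tE : th u = t by exact: crd_inj.
move: xu pKu Hxu; rewrite slackE // tE => xu pKu Hxu.
apply: kkt_certificate xu Hxu pKu; last exact: c_neq0.
by apply: slack_sym => [|i]; [exact: F_sym | exact: G_sym].
Qed.
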